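(* Let $k\ge 1$ be an integer. The generating function $Q_k(z)=\prod_{n=1}^{\infty}(1+z^{n^k})$, $|z|<1$, of partitions into distinct $k$-th powers belongs to the Hayman class.
   Context: Let $\mathcal{K}$ be the class of nonconstant power series $f(z)=\sum_{n\ge 0}a_nz^n$ with nonnegative coefficients, radius of convergence $R>0$, and $a_0>0$. The Khinchin family of $f\in\mathcal{K}$ is the family $(Z_t)_{t\in[0,R)}$ of random variables with values in $\{0,1,2,\dots\}$ with $\mathbb{P}(Z_t=n)=a_nt^n/f(t)$ for $t\in(0,R)$, $n\ge 0$, and $Z_0\equiv 0$. Its mean and variance are $m_f(t)=\mathbb{E}(Z_t)=tf'(t)/f(t)$ and $\sigma_f^2(t)=\mathbb{V}(Z_t)=t\,m_f'(t)$; one has $\sigma_f(t)>0$ for $t\in(0,R)$, and the normalized variable is $\breve{Z}_t=(Z_t-m_f(t))/\sigma_f(t)$ for $t\in(0,R)$. A power series $f\in\mathcal{K}$ with radius of convergence $R$ is in the Hayman class if $\lim_{t\uparrow R}\sigma_f(t)=+\infty$ and there exists a function $h:[0,R)\to(0,\pi]$ (the cut) such that both $$\lim_{t\uparrow R}\ \sup_{|\theta|\le h(t)\sigma_f(t)}\Big|\mathbb{E}(e^{i\theta\breve{Z}_t})\,e^{\theta^2/2}-1\Big|=0$$ and $$\lim_{t\uparrow R}\ \sigma_f(t)\sup_{h(t)\sigma_f(t)<|\theta|\le\pi\sigma_f(t)}\big|\mathbb{E}(e^{i\theta\breve{Z}_t})\big|=0.$$ The series $Q_k$ belongs to $\mathcal{K}$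 and has radius of convergence $R=1$. *)

(* Defs.v *)
(* Coquelicot over the real numbers of Stdlib. *)
From Stdlib Require Import Reals Arith Compare_dec Lra Lia.
From Coquelicot Require Import Coquelicot.
Open Scope R_scope.

(* A power series is represented by its sequence of coefficients. *)

Definition in_K (a : nat -> R) : Prop :=
  (forall n, 0 <= a n) /\
  0 < a O /\
  (exists n, (1 <= n)%nat /\ a n <> 0) /\
  Rbar_lt 0 (CV_radius a).

(* P(Z_t = n); since t ^ 0 = 1 for t = 0 too, the law at t = 0 is the point
   mass at 0. Everything below depends on Z_t only through its law. *)
Definition khinchin_law (a : nat -> R) (t : R) (n : nat) : R :=
  a n * t ^ n / PSeries a t.

(* E(g(Z_t)) *)
Definition khinchin_E (a : nat -> R) (t : R) (g : nat -> R) : R :=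
  Series (fun n => g n * khinchin_law a t n).

Definition khinchin_mean (a : nat -> R) (t : R) : R :=
  khinchin_E a t INR.

Definition khinchin_var (a : nat -> R) (t : R) : R :=
  khinchin_E a t (fun n => (INR n - khinchin_mean a t) ^ 2).

Definition khinchin_sigma (a : nat -> R) (t : R) : R :=
  sqrt (khinchin_var a t).

(* The value of the normalized variable on the event Z_t = n. *)
Definition khinchin_normalized (a : nat -> R) (t : R) (n : nat) : R :=
  (INR n - khinchin_mean a t) / khinchin_sigma a t.

(* E(exp(i theta Z)) for the normalized variable Z, with real part
   E(cos(theta Z)) and imaginary part E(sin(theta Z)). *)
Definition khinchin_charfun (a : nat -> R) (t theta : R) : C :=
  (khinchin_E a t (fun n => cos (theta * khinchin_normalized a t n)),
   khinchin_E a t (fun n => sin (theta * khinchin_normalized a t n))).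

(* The supremum of a nonnegative function g over {x | P x}, taken in
   [0, +oo), so that it is 0 over the empty set. The projection from Rbar is
   harmless for the two uses below, where the function is bounded, by
   1 + exp (theta^2 / 2) with theta in a bounded set and by 1 respectively. *)
Definition sup_nonneg (P : R -> Prop) (g : R -> R) : R :=
  real (Lub_Rbar (fun y => y = 0 \/ exists x, P x /\ y = g x)).

(* The filter of t tending to r from below; r may be p_infty. *)
Definition Rbar_at_left (r : Rbar) : (R -> Prop) -> Prop :=
  within (fun t : R => Rbar_lt t r) (Rbar_locally r).

Definition in_Hayman (a : nat -> R) : Prop :=
  in_K a /\
  filterlim (khinchin_sigma a) (Rbar_at_left (CV_radius a))
    (Rbar_locally p_infty) /\
  exists h : R -> R,
    (forall t : R, 0 <= t -> Rbar_lt t (CV_radius a) -> 0 < h t <= PI) /\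
    filterlim
      (fun t =>
         sup_nonneg
           (fun theta => Rabs theta <= h t * khinchin_sigma a t)
           (fun theta =>
              Cmod (khinchin_charfun a t theta * RtoC (exp (theta ^ 2 / 2))
                    - RtoC 1)%C))
      (Rbar_at_left (CV_radius a)) (locally 0) /\
    filterlim
      (fun t =>
         khinchin_sigma a t *
         sup_nonneg
           (fun theta => h t * khinchin_sigma a t < Rabs theta
                         <= PI * khinchin_sigma a t)
           (fun theta => Cmod (khinchin_charfun a t theta)))
      (Rbar_at_left (CV_radius a)) (locally 0).

(* Coefficients of prod_{n=1}^{N} (1 + z^(n^k)), using
   P (1 + z^d) = P + z^d P. *)
Fixpoint Q_partial (k N : nat) : nat -> R :=
  match N with
  | O => fun m => match m with O => 1 | S _ => 0 end
  | S N' => PS_plus (Q_partial k N')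
                    (PS_incr_n (Q_partial k N') (N ^ k))
  end.

(* Coefficients of Q_k, for k >= 1: the factors with n > m only involve powers
   of z greater than m besides the constant 1, so the coefficient of z^m in
   the partial products is stationary from N = m on. Q_series_product below
   relates this series to the infinite product as a function on |z| < 1. *)
Definition Q_series (k : nat) : nat -> R := fun m => Q_partial k m m.

(* prod_{n=1}^{N} (1 + z^(n^k)) *)
Fixpoint Q_prod (k : nat) (z : C) (N : nat) : C :=
  match N with
  | O => RtoC 1
  | S N' => (Q_prod k z N' * (RtoC 1 + z ^ (N ^ k)))%C
  end.

Lemma le_pow_k (k N : nat) : (1 <= N)%nat -> (1 <= k)%nat -> (N <= N ^ k)%nat.
Proof.
  intros HN Hk. destruct k as [|k]; [lia|].
  simpl. assert (N ^ k <> 0)%nat by (apply Nat.pow_nonzero; lia). nia.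
Qed.

Lemma Q_partial_S (k N m : nat) :
  Q_partial k (S N) m =
  Q_partial k N m +
  (if le_lt_dec (S N ^ k) m then Q_partial k N (m - S N ^ k) else 0).
Proof.
  change (Q_partial k (S N) m) with
    (Q_partial k N m + PS_incr_n (Q_partial k N) (S N ^ k) m).
  now rewrite PS_incr_n_simplify.
Qed.

Lemma Q_partial_ge_0 (k N m : nat) : 0 <= Q_partial k N m.
Proof.
  revert m; induction N as [|N IH]; intros m.
  - simpl; destruct m; lra.
  - rewrite Q_partial_S. pose proof (IH m).
    destruct le_lt_dec as [h|h]; [pose proof (IH (m - S N ^ k)%nat)|]; lra.
Qed.

Lemma Q_partial_incr (k N m : nat) : Q_partial k N m <= Q_partial k (S N) m.
Proof.
  rewrite Q_partial_S.
  destruct le_lt_dec as [h|h];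
    [pose proof (Q_partial_ge_0 k N (m - S N ^ k)%nat)|]; lra.
Qed.

Lemma Q_partial_eq (k m d : nat) :
  (1 <= k)%nat -> Q_partial k (m + d) m = Q_series k m.
Proof.
  intros Hk; induction d as [|d IH].
  - now rewrite Nat.add_0_r.
  - rewrite Nat.add_succ_r, Q_partial_S.
    pose proof (le_pow_k k (S (m + d)) ltac:(lia) Hk).
    destruct le_lt_dec as [h|h]; [lia|]. rewrite IH; lra.
Qed.

Lemma Q_partial_le (k N m : nat) :
  (1 <= k)%nat -> Q_partial k N m <= Q_series k m.
Proof.
  intros Hk. destruct (Nat.le_gt_cases m N) as [h|h].
  - replace N with (m + (N - m))%nat by lia.
    rewrite Q_partial_eq by easy. lra.
  - unfold Q_series. replace m with (N + (m - N))%nat at 2 by lia.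
    generalize (m - N)%nat; intros d.
    induction d as [|d IH]; [rewrite Nat.add_0_r; lra|].
    rewrite Nat.add_succ_r. pose proof (Q_partial_incr k (N + d) m). lra.
Qed.

Lemma Cpow_n (z : C) (n : nat) : pow_n (K := C_AbsRing) z n = (z ^ n)%C.
Proof. induction n as [|n IH]; [easy|]. simpl. now rewrite IH. Qed.

Lemma Q_partial_is_pseries (k N : nat) (z : C) :
  is_pseries (K := C_AbsRing) (V := C_NormedModule)
    (fun m => RtoC (Q_partial k N m)) z (Q_prod k z N).
Proof.
  induction N as [|N IH].
  - unfold is_pseries. simpl Q_prod.
    apply filterlim_ext with (fun _ : nat => RtoC 1).
    + intros n; induction n as [|n IHn].
      * rewrite sum_O. simpl. unfold scal; simpl. unfold mult; simpl.
        change (@one C_AbsRing) with (RtoC 1). ring.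
      * rewrite sum_Sn, <- IHn. unfold scal, plus; simpl. unfold mult; simpl.
        ring.
    + apply filterlim_const.
  - pose proof (is_pseries_plus _ _ _ _ _ IH
      (is_pseries_incr_n _ (S N ^ k) _ _ IH)) as H.
    replace (Q_prod k z (S N)) with
      (plus (Q_prod k z N : C_NormedModule)
         (scal (pow_n (K := C_AbsRing) z (S N ^ k)) (Q_prod k z N : C_NormedModule))).
    2:{ rewrite Cpow_n. change (Q_prod k z (S N)) with
          (Q_prod k z N * (RtoC 1 + z ^ (S N ^ k)))%C.
        unfold plus, scal; simpl. unfold mult; simpl. ring. }
    eapply is_pseries_ext; [|exact H].
    intros m. rewrite Q_partial_S. unfold PS_plus.
    rewrite PS_incr_n_simplify.
    destruct le_lt_dec; now rewrite RtoC_plus.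
Qed.

Lemma Q_partial_is_series (k N : nat) (z : C) :
  is_series (fun m => (RtoC (Q_partial k N m) * z ^ m)%C) (Q_prod k z N).
Proof.
  eapply is_series_ext; [|exact (Q_partial_is_pseries k N z)].
  intros m; simpl. rewrite Cpow_n. unfold scal; simpl; unfold mult; simpl. ring.
Qed.

Lemma RtoC_sum_n (u : nat -> R) (n : nat) :
  sum_n (fun m => RtoC (u m)) n = RtoC (sum_n u n).
Proof.
  induction n as [|n IH]; [now rewrite !sum_O|].
  rewrite !sum_Sn, IH. symmetry. apply RtoC_plus.
Qed.

Fixpoint Q_prod_R (k : nat) (r : R) (N : nat) : R :=
  match N with
  | O => 1
  | S N' => Q_prod_R k r N' * (1 + r ^ (N ^ k))
  end.

Lemma Q_prod_RtoC (k : nat) (r : R) (N : nat) :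
  Q_prod k (RtoC r) N = RtoC (Q_prod_R k r N).
Proof.
  induction N as [|N IH]; [easy|].
  change (Q_prod k (RtoC r) (S N)) with
    (Q_prod k (RtoC r) N * (RtoC 1 + RtoC r ^ (S N ^ k)))%C.
  change (Q_prod_R k r (S N)) with (Q_prod_R k r N * (1 + r ^ (S N ^ k))).
  now rewrite IH, RtoC_mult, RtoC_plus, RtoC_pow.
Qed.

Lemma Q_partial_is_series_R (k N : nat) (r : R) :
  is_series (fun m => Q_partial k N m * r ^ m) (Q_prod_R k r N).
Proof.
  pose proof (Q_partial_is_series k N (RtoC r)) as H.
  rewrite Q_prod_RtoC in H.
  assert (H1 : filterlim (fun n => RtoC (sum_n (fun m => Q_partial k N m * r ^ m) n))
                 eventually (locally (RtoC (Q_prod_R k r N) : C_UniformSpace))).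
  { eapply filterlim_ext; [|exact H]. intros n. rewrite <- RtoC_sum_n.
    apply sum_n_ext; intros m. now rewrite RtoC_mult, RtoC_pow. }
  intros P [eps HP]. unfold filtermap.
  specialize (H1 (fun z : C => P (fst z))).
  apply H1. exists eps. intros z [Hz _]. now apply HP.
Qed.

Lemma exp_incr (x y : R) : x <= y -> exp x <= exp y.
Proof.
  intros [h| -> ]; [left; now apply exp_increasing|lra].
Qed.

Lemma pow_antitone (r : R) (n m : nat) :
  0 <= r <= 1 -> (n <= m)%nat -> r ^ m <= r ^ n.
Proof.
  intros Hr h. replace m with (n + (m - n))%nat by lia.
  rewrite pow_add. rewrite <- (Rmult_1_r (r ^ n)) at 2.
  apply Rmult_le_compat_l; [now apply pow_le|].
  rewrite <- (pow1 (m - n)). now apply pow_incr.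
Qed.

Lemma Q_prod_R_bound (k : nat) (r : R) (N : nat) :
  (1 <= k)%nat -> 0 <= r < 1 -> 0 < Q_prod_R k r N <= exp (/ (1 - r)).
Proof.
  intros Hk Hr.
  assert (H : 0 < Q_prod_R k r N <= exp (sum_n (fun n => r ^ n) N)).
  { induction N as [|N IH].
    - rewrite sum_O; simpl. pose proof (exp_ineq1_le 1); lra.
    - rewrite sum_Sn. change plus with Rplus. rewrite exp_plus.
      change (Q_prod_R k r (S N)) with (Q_prod_R k r N * (1 + r ^ (S N ^ k))).
      assert (0 <= r ^ (S N ^ k)) by (apply pow_le; lra).
      assert (r ^ (S N ^ k) <= r ^ S N).
      { apply pow_antitone; [lra|]. apply le_pow_k; lia. }
      pose proof (exp_ineq1_le (r ^ S N)).
      split; [apply Rmult_lt_0_compat; lra|].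
      apply Rmult_le_compat; lra. }
  split; [easy|]. apply Rle_trans with (1 := proj2 H).
  apply exp_incr.
  apply (is_lim_seq_incr_compare (sum_n (fun n => r ^ n))).
  - apply is_series_geom. rewrite Rabs_pos_eq; lra.
  - intros n. rewrite sum_Sn. change plus with Rplus.
    assert (0 <= r ^ S n) by (apply pow_le; lra). lra.
Qed.

Lemma Q_series_is_series_R (k : nat) (r : R) :
  (1 <= k)%nat -> 0 <= r < 1 ->
  exists s, is_series (fun m => Q_series k m * r ^ m) s /\
            is_lim_seq (Q_prod_R k r) s.
Proof.
  intros Hk Hr.
  assert (Hpos : forall N m, 0 <= Q_partial k N m * r ^ m).
  { intros; apply Rmult_le_pos; [apply Q_partial_ge_0|apply pow_le; lra]. }
  assert (Hincr : forall (N : nat) (u : nat -> R), (forall m, 0 <= u m) ->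
            sum_n u N <= sum_n u (S N)).
  { intros N u Hu. rewrite sum_Sn. change plus with Rplus.
    pose proof (Hu (S N)); lra. }
  assert (Hle : forall M, sum_n (fun m => Q_series k m * r ^ m) M <= Q_prod_R k r M).
  { intros M.
    rewrite (sum_n_ext_loc _ (fun m => Q_partial k M m * r ^ m)).
    2:{ intros n Hn. rewrite <- (Q_partial_eq k n (M - n)) by easy.
        now replace (n + (M - n))%nat with M by lia. }
    apply (is_lim_seq_incr_compare (sum_n (fun m => Q_partial k M m * r ^ m))).
    - apply Q_partial_is_series_R.
    - intros n; now apply Hincr. }
  destruct (ex_finite_lim_seq_incr (sum_n (fun m => Q_series k m * r ^ m))
              (exp (/ (1 - r)))) as [s Hs].
  - intros n; apply Hincr; intros m; apply Hpos.
  - intros n. apply Rle_trans with (1 := Hle n). now apply Q_prod_R_bound.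
  - exists s; split; [exact Hs|].
    apply is_lim_seq_le_le with (sum_n (fun m => Q_series k m * r ^ m)) (fun _ => s).
    + intros N; split; [apply Hle|].
      change (Rbar_le (Q_prod_R k r N) s).
      eapply is_lim_seq_le; [|apply Q_partial_is_series_R|exact Hs].
      intros n; apply sum_n_m_le; intros m.
      apply Rmult_le_compat_r; [apply pow_le; lra|now apply Q_partial_le].
    + exact Hs.
    + apply is_lim_seq_const.
Qed.

Lemma Cmod_series_le (c : nat -> C) (d : nat -> R) (l : C) (s : R) :
  (forall n, Cmod (c n) <= d n) -> is_series c l -> is_series d s ->
  Cmod l <= s.
Proof.
  intros Hcd Hc Hd. change (Rbar_le (Cmod l) s).
  apply is_lim_seq_le with (fun n => Cmod (sum_n c n)) (sum_n d).
  - intros n; induction n as [|n IH]; [now rewrite !sum_O|].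
    rewrite !sum_Sn. eapply Rle_trans; [apply Cmod_triangle|].
    now apply Rplus_le_compat.
  - apply (filterlim_comp _ _ _ (sum_n c) Cmod eventually (locally l)); [exact Hc|].
    exact (@filterlim_norm C_AbsRing C_NormedModule l).
  - exact Hd.
Qed.

(* On |z| < 1 the power series Q_k converges,
   and its sum is prod_{n>=1} (1 + z^(n^k)). *)
Lemma Q_series_product (k : nat) (z : C) :
  (1 <= k)%nat -> Cmod z < 1 ->
  exists l : C,
    is_series (fun m => (RtoC (Q_series k m) * z ^ m)%C) l /\
    filterlim (Q_prod k z) eventually (locally l).
Proof.
  intros Hk Hz. pose proof (Cmod_ge_0 z) as Hz0.
  destruct (Q_series_is_series_R k (Cmod z) Hk (conj Hz0 Hz)) as [s [Hs HP]].
  assert (Hpos : forall m, 0 <= Q_series k m) by (intros; apply Q_partial_ge_0).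
  destruct (@ex_series_le C_AbsRing C_CompleteNormedModule
    (fun m => (RtoC (Q_series k m) * z ^ m)%C)
    (fun m => Q_series k m * Cmod z ^ m)) as [l Hl].
  - intros m. change norm with Cmod.
    rewrite Cmod_mult, Cmod_R, Cmod_pow, Rabs_pos_eq by apply Hpos. lra.
  - now exists s.
  - exists l; split; [exact Hl|].
    assert (H : forall N, Cmod (Q_prod k z N - l)%C <= s - Q_prod_R k (Cmod z) N).
    { intros N.
      rewrite <- Cmod_opp.
      replace (- (Q_prod k z N - l))%C with (l - Q_prod k z N)%C by ring.
      eapply Cmod_series_le.
      2: exact (is_series_minus _ _ _ _ Hl (Q_partial_is_series k N z)).
      2: exact (is_series_minus _ _ _ _ Hs (Q_partial_is_series_R k N (Cmod z))).
      intros m; simpl.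
      pose proof (Q_partial_le k N m Hk).
      unfold plus, opp; simpl.
      replace (RtoC (Q_series k m) * z ^ m + - (RtoC (Q_partial k N m) * z ^ m))%C
        with (RtoC (Q_series k m - Q_partial k N m) * z ^ m)%C
        by (rewrite RtoC_minus; ring).
      rewrite Cmod_mult, Cmod_R, Cmod_pow, Rabs_pos_eq by lra. lra. }
    intros P HPl.
    apply (@locally_norm_le_locally C_AbsRing C_NormedModule l) in HPl.
    destruct HPl as [eps HPl].
    apply is_lim_seq_spec in HP. destruct (HP eps) as [N0 HN0].
    exists N0. intros N HN. apply HPl. unfold ball_norm.
    change (Cmod (Q_prod k z N - l)%C < eps).
    apply Rle_lt_trans with (1 := H N).
    specialize (HN0 N HN). apply Rabs_def2 in HN0. lra.
Qed.

(* Main.v *)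
Require Import Defs.
From Stdlib Require Import Reals ZArith Lra Lia Psatz.
From Coquelicot Require Import Coquelicot.
Open Scope R_scope.

(** For t = exp (- s), the variable Z_t is a sum of independent terms
    n ^ k B_n, where B_n is Bernoulli of parameter
    p_n = t ^ (n ^ k) / (1 + t ^ (n ^ k)). Its centred characteristic function at
    u is therefore the product of the functions bern_charfun p_n (u n ^ k)
    (khinchin_charfun_Q), and its mean and variance are the sums of those of the
    terms (khinchin_mean_Q, khinchin_var_Q). Let N be an integer such that
    s is comparable to N ^ (- k), and cut at h = N ^ (- k - 2/5).

    Major arc, |u| <= h. With v = u n ^ k, each factor multiplied by
    exp (v ^ 2 p_n (1 - p_n) / 2) differs from 1 by O(|v| ^ 3 p_n (1 - p_n))
    (bern_charfun_gaussian). The sum over n of these errors is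
    O(|u| ^ 3 N ^ (3 k + 1)) (psum_cubic_exp_le), which is O(N ^ (-1/5)), so the
    whole product is close to the Gaussian, in relative error.

    Minor arc, h < |u| <= PI. The modulus of the product is at most
    exp (- S / 6), where S is the sum of sin (w n ^ k) ^ 2 over n <= N and
    w = u / 2 (charfun_energy). The arithmetic input is a lower bound
    S >= c N min (1, |w| N ^ k) ^ 2, for |w| <= PI / 2
    (sin_energy_lower_bound), so that S is at least of order N ^ (1/5), while the
    standard deviation grows only like a power of N.

    The lower bound rests on k-fold differencing. The k-th difference with step
    d of n ^ k is k! d ^ k, so if S / N is small then k! w d ^ k is close to a
    multiple of PI for every d up to a constant times N. Since d ^ k grows by
    bounded factors, the distance b from k! w to the nearest multiple of PI then
    satisfies: |b| N ^ k is small (sin_small_on_powers). Hence w n ^ k is almost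
    constant modulo PI along n = 1 (mod k!), which makes sin w, and so w itself,
    small (sqr_sin_le_energy). The nearest multiple of PI is therefore 0, and
    |w| N ^ k is small (small_energy). *)

(** * Elementary estimates for sine, cosine and exponential *)

Lemma exp_mul_INR (n : nat) (x : R) : exp (INR n * x) = exp x ^ n.
Proof.
  induction n as [|n IH]; [simpl; now rewrite Rmult_0_l, exp_0|].
  rewrite S_INR, Rmult_plus_distr_r, exp_plus, IH, Rmult_1_l. simpl; ring.
Qed.

Lemma pow_mul_exp_le (n : nat) (y : R) :
  (1 <= n)%nat -> 0 <= y -> y ^ n * exp (- y) <= INR n ^ n.
Proof.
  intros Hn Hy.
  assert (HN : 0 < INR n) by (apply lt_0_INR; lia).
  assert (He : exp y = exp (y / INR n) ^ n).
  { rewrite <- exp_mul_INR. f_equal. field. lra. }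
  assert (Hz : 0 <= y / INR n) by (apply Rle_div_r; lra).
  assert (H : (y / INR n) ^ n <= exp y).
  { rewrite He. apply pow_incr. pose proof (exp_ineq1_le (y / INR n)). lra. }
  unfold Rdiv in H. rewrite Rpow_mult_distr, pow_inv in H.
  assert (HNn : 0 < INR n ^ n) by now apply pow_lt.
  rewrite exp_Ropp. pose proof (exp_pos y).
  apply Rle_div_l; [easy|].
  apply Rmult_le_reg_r with (/ INR n ^ n); [now apply Rinv_0_lt_compat|].
  replace (INR n ^ n * exp y * / INR n ^ n) with (exp y) by (field; lra). lra.
Qed.

Lemma sin_taylor_nonneg (x : R) : 0 <= x -> 0 <= x - sin x <= x ^ 3 / 6.
Proof.
  intros Hx. split.
  - destruct Hx as [Hx| <-]; [pose proof (sin_lt_x x Hx); lra|rewrite sin_0; lra].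
  - destruct (Rle_lt_dec x 4) as [h|h].
    + pose proof (pre_sin_bound x 0 Hx h) as [H _].
      unfold sin_approx, sin_term in H. simpl in H. lra.
    + pose proof (SIN_bound x). nra.
Qed.

Lemma sin_taylor (x : R) : Rabs (sin x - x) <= Rabs x ^ 3 / 6.
Proof.
  destruct (Rle_lt_dec 0 x) as [h|h].
  - pose proof (sin_taylor_nonneg x h).
    rewrite Rabs_left1, (Rabs_pos_eq x) by lra. lra.
  - pose proof (sin_taylor_nonneg (- x) ltac:(lra)) as H. rewrite sin_neg in H.
    rewrite Rabs_pos_eq, (Rabs_left x) by lra. lra.
Qed.

Lemma cos_taylor (x : R) : Rabs (cos x - 1 + x ^ 2 / 2) <= Rabs x ^ 3 / 2.
Proof.
  assert (P : forall x, 0 <= x -> Rabs (cos x - 1 + x ^ 2 / 2) <= x ^ 3 / 2).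
  { clear x; intros x Hx. set (y := x / 2).
    replace x with (2 * y) by (unfold y; field).
    rewrite cos_2a_sin.
    assert (Hy : 0 <= y) by (unfold y; lra).
    pose proof (sin_taylor_nonneg y Hy) as [H1 H2].
    pose proof (SIN_bound y).
    assert (H3 : y - sin y <= y ^ 2) by (destruct (Rle_lt_dec y 2); nra).
    assert (H4 : 0 <= y + sin y) by (destruct (Rle_lt_dec y 2); nra).
    replace (1 - 2 * sin y * sin y - 1 + (2 * y) ^ 2 / 2)
      with (2 * ((y - sin y) * (y + sin y))) by field.
    rewrite Rabs_pos_eq by nra.
    assert ((y - sin y) * (y + sin y) <= y ^ 2 * (2 * y)).
    { apply Rmult_le_compat; lra. }
    lra. }
  destruct (Rle_lt_dec 0 x) as [h|h].
  - rewrite (Rabs_pos_eq x) by easy. now apply P.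
  - rewrite <- (cos_neg x), (Rabs_left x) by easy.
    replace (x ^ 2) with ((- x) ^ 2) by ring. apply P. lra.
Qed.

(** Jordan's inequality with the constant 1/3 in place of 2/PI. *)
Lemma abs_le_3_abs_sin (x : R) : Rabs x <= PI / 2 -> Rabs x <= 3 * Rabs (sin x).
Proof.
  assert (P : forall x, 0 <= x <= PI / 2 -> x <= 3 * sin x).
  { clear x; intros x [h0 h]. pose proof (sin_taylor_nonneg x h0). pose proof PI_4.
    assert (x ^ 2 <= 4) by nra. assert (x * x ^ 2 <= x * 4) by nra. simpl in *. nra. }
  intros h. destruct (Rle_lt_dec 0 x) as [h0|h0].
  - rewrite Rabs_pos_eq in h |- * by easy. pose proof (P x (conj h0 h)).
    pose proof (Rle_abs (sin x)). lra.
  - rewrite Rabs_left in h |- * by easy. pose proof (P (- x) ltac:(lra)) as H.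
    rewrite sin_neg in H. pose proof (Rabs_maj2 (sin x)). lra.
Qed.

Lemma abs_sin_plus_le (x y : R) : Rabs (sin (x + y)) <= Rabs (sin x) + Rabs (sin y).
Proof.
  rewrite sin_plus. eapply Rle_trans; [apply Rabs_triang|].
  rewrite !Rabs_mult.
  pose proof (Rabs_pos (sin x)). pose proof (Rabs_pos (sin y)).
  assert (Rabs (cos x) <= 1) by (apply Rabs_le; pose proof (COS_bound x); lra).
  assert (Rabs (cos y) <= 1) by (apply Rabs_le; pose proof (COS_bound y); lra).
  nra.
Qed.

Lemma abs_sin_minus_le (x y : R) : Rabs (sin (x - y)) <= Rabs (sin x) + Rabs (sin y).
Proof.
  rewrite <- (Rabs_Ropp (sin y)), <- sin_neg. apply (abs_sin_plus_le x (- y)).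
Qed.

Lemma sqr_sin_minus_le (x y : R) : sin (x - y) ^ 2 <= 2 * (sin x ^ 2 + sin y ^ 2).
Proof.
  pose proof (abs_sin_minus_le x y) as H.
  rewrite <- (pow2_abs (sin (x - y))), <- (pow2_abs (sin x)), <- (pow2_abs (sin y)).
  pose proof (pow_incr _ _ 2 (conj (Rabs_pos (sin (x - y))) H)).
  pose proof (pow2_ge_0 (Rabs (sin x) - Rabs (sin y))). lra.
Qed.

Lemma abs_sin_le (x : R) : Rabs (sin x) <= Rabs x.
Proof.
  assert (P : forall x, 0 <= x -> Rabs (sin x) <= x).
  { clear x; intros x h. pose proof (sin_taylor_nonneg x h). pose proof (SIN_bound x).
    apply Rabs_le. split; [|lra]. destruct (Rle_lt_dec x 1); [|lra].
    assert (x ^ 3 <= x) by (assert (x * x <= 1) by nra; simpl; nra). lra. }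
  destruct (Rle_lt_dec 0 x) as [h|h].
  - rewrite (Rabs_pos_eq x) by easy. now apply P.
  - rewrite <- (Rabs_Ropp x), <- Rabs_Ropp, <- sin_neg, (Rabs_pos_eq (- x)) by lra.
    apply P; lra.
Qed.

Lemma abs_sin_plus_PI_multiple (x : R) (a : Z) :
  Rabs (sin (x + IZR a * PI)) = Rabs (sin x).
Proof.
  assert (P : forall n x, Rabs (sin (x + INR n * PI)) = Rabs (sin x)).
  { induction n as [|n IH]; intros y.
    - simpl. f_equal; f_equal; ring.
    - rewrite S_INR. replace (y + (INR n + 1) * PI) with (y + INR n * PI + PI) by ring.
      now rewrite neg_sin, Rabs_Ropp. }
  destruct (Z_le_gt_dec 0 a) as [h|h].
  - rewrite <- (Z2Nat.id a h), <- INR_IZR_INZ. apply P.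
  - rewrite <- (P (Z.to_nat (- a)) (x + IZR a * PI)).
    rewrite INR_IZR_INZ, Z2Nat.id, opp_IZR by lia. f_equal; f_equal; ring.
Qed.

Lemma exists_nearest_PI_multiple (x : R) : exists a : Z, Rabs (x - IZR a * PI) <= PI / 2.
Proof.
  pose proof PI_RGT_0.
  pose proof (archimed (x / PI - / 2)) as [H1 H2].
  exists (up (x / PI - / 2)).
  set (r := IZR (up (x / PI - / 2))) in *.
  replace (x - r * PI) with ((x / PI - r) * PI) by (field; lra).
  rewrite Rabs_mult, (Rabs_pos_eq PI) by lra.
  assert (Rabs (x / PI - r) <= / 2) by (apply Rabs_le; lra). nra.
Qed.

(** * Sine sums over k-th powers *)

(** The indices start from 1, like those of the factors of Q_prod. *)
Fixpoint psum (f : nat -> R) (N : nat) : R :=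
  match N with
  | O => 0
  | S N' => psum f N' + f N
  end.

Lemma psum_S (f : nat -> R) (N : nat) : psum f (S N) = psum f N + f (S N).
Proof. reflexivity. Qed.

Lemma psum_le (f g : nat -> R) (N : nat) :
  (forall n, (1 <= n <= N)%nat -> f n <= g n) -> psum f N <= psum g N.
Proof.
  induction N as [|N IH]; intros H; simpl; [lra|].
  apply Rplus_le_compat; [apply IH; intros; apply H; lia|apply H; lia].
Qed.

Lemma psum_ext (f g : nat -> R) (N : nat) :
  (forall n, (1 <= n <= N)%nat -> f n = g n) -> psum f N = psum g N.
Proof.
  intros H. apply Rle_antisym; apply psum_le; intros n Hn; rewrite (H n Hn); lra.
Qed.

Lemma psum_scal (c : R) (f : nat -> R) (N : nat) :
  psum (fun n => c * f n) N = c * psum f N.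
Proof. induction N as [|N IH]; simpl; [ring|rewrite IH; ring]. Qed.

Lemma psum_plus (f g : nat -> R) (N : nat) :
  psum (fun n => f n + g n) N = psum f N + psum g N.
Proof. induction N as [|N IH]; simpl; [ring|rewrite IH; ring]. Qed.

Lemma psum_const (c : R) (N : nat) : psum (fun _ => c) N = INR N * c.
Proof. induction N as [|N IH]; [simpl; ring|]. rewrite S_INR; simpl; rewrite IH; ring. Qed.

Lemma psum_add (f : nat -> R) (N L : nat) :
  psum f (N + L) = psum f N + psum (fun n => f (N + n)%nat) L.
Proof.
  induction L as [|L IH]; [rewrite Nat.add_0_r; simpl; ring|].
  rewrite Nat.add_succ_r; simpl. rewrite IH, Nat.add_succ_r. ring.
Qed.

Lemma psum_nonneg (f : nat -> R) (N : nat) : (forall n, 0 <= f n) -> 0 <= psum f N.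
Proof.
  intros H. induction N as [|N IH]; simpl; [lra|]. pose proof (H (S N)). lra.
Qed.

Lemma psum_mono (f : nat -> R) (N M : nat) :
  (forall n, 0 <= f n) -> (N <= M)%nat -> psum f N <= psum f M.
Proof.
  intros H h. replace M with (N + (M - N))%nat by lia. rewrite psum_add.
  pose proof (psum_nonneg (fun n => f (N + n)%nat) (M - N) ltac:(intros; apply H)). lra.
Qed.

Lemma term_le_psum (f : nat -> R) (n N : nat) :
  (forall n, 0 <= f n) -> (1 <= n <= N)%nat -> f n <= psum f N.
Proof.
  intros H h. destruct n as [|n]; [lia|].
  pose proof (psum_mono f (S n) N H ltac:(lia)) as H1. simpl in H1.
  pose proof (psum_nonneg f n H). lra.
Qed.

Lemma psum_progression_le (f : nat -> R) (q m : nat) :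
  (forall n, 0 <= f n) -> (1 <= q)%nat ->
  psum (fun i => f (1 + q * (i - 1))%nat) m <= psum f (q * m).
Proof.
  intros H Hq. induction m as [|m IH]; [apply psum_nonneg, H|].
  pose proof (psum_mono f (S (q * m)) (q * S m) H ltac:(nia)) as H1.
  simpl psum in H1 at 1. simpl psum at 1.
  replace (m - 0)%nat with m by lia. simpl in IH. lra.
Qed.

Fixpoint iter_diff (d : nat) (j : nat) (f : nat -> R) (n : nat) : R :=
  match j with
  | O => f n
  | S j' => iter_diff d j' f (n + d) - iter_diff d j' f n
  end.

(** The Leibniz rule for the product with the identity. *)
Lemma iter_diff_mul_id (d j : nat) (f : nat -> R) (n : nat) :
  iter_diff d (S j) (fun m => INR m * f m) n =
  INR n * iter_diff d (S j) f n + INR (S j) * INR d * iter_diff d j f (n + d).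
Proof.
  revert n; induction j as [|j IH]; intros n.
  - simpl. rewrite plus_INR. ring.
  - change (iter_diff d (S (S j)) (fun m => INR m * f m) n) with
      (iter_diff d (S j) (fun m => INR m * f m) (n + d)
       - iter_diff d (S j) (fun m => INR m * f m) n).
    rewrite !IH. simpl iter_diff. rewrite plus_INR, !S_INR. ring.
Qed.

Lemma iter_diff_ext (d j : nat) (f g : nat -> R) (n : nat) :
  (forall m, f m = g m) -> iter_diff d j f n = iter_diff d j g n.
Proof.
  intros H; revert n; induction j as [|j IH]; intros n; simpl; [apply H|].
  now rewrite !IH.
Qed.

(** Induction on k through the Leibniz rule: n ^ (k + 1) is n times n ^ k, whose
    difference of order k + 1 vanishes. *)
Lemma iter_diff_pow (d k n : nat) :
  iter_diff d k (fun m => INR m ^ k) n = INR (fact k) * INR d ^ k.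
Proof.
  revert n; induction k as [|k IH]; intros n.
  - simpl. ring.
  - rewrite (iter_diff_ext d (S k) _ (fun m => INR m * INR m ^ k)) by reflexivity.
    rewrite iter_diff_mul_id, IH.
    change (iter_diff d (S k) (fun m => INR m ^ k) n) with
      (iter_diff d k (fun m => INR m ^ k) (n + d) - iter_diff d k (fun m => INR m ^ k) n).
    rewrite !IH, fact_simpl, mult_INR. simpl pow. ring.
Qed.

(** Each differencing costs a factor 4, because sin is subadditive in absolute
    value. *)
Lemma psum_sqr_sin_iter_diff_le (w : R) (d j L : nat) (f : nat -> R) :
  psum (fun n => sin (w * iter_diff d j f n) ^ 2) L
  <= 4 ^ j * psum (fun n => sin (w * f n) ^ 2) (L + j * d).
Proof.
  revert L; induction j as [|j IH]; intros L.
  - simpl. rewrite Nat.add_0_r. lra.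
  - set (g := fun n => sin (w * iter_diff d j f n) ^ 2).
    assert (Hg : forall n, 0 <= g n) by (intros; apply pow2_ge_0).
    apply Rle_trans with (psum (fun n => 2 * (g (d + n)%nat + g n)) L).
    { apply psum_le; intros n _. unfold g.
      change (iter_diff d (S j) f n) with (iter_diff d j f (n + d) - iter_diff d j f n).
      rewrite Rmult_minus_distr_l, (Nat.add_comm d n). apply sqr_sin_minus_le. }
    rewrite psum_scal, psum_plus.
    pose proof (psum_add g d L) as H1. pose proof (psum_nonneg g d Hg).
    pose proof (psum_mono g L (d + L) Hg ltac:(lia)).
    specialize (IH (d + L)%nat). fold g in IH.
    replace (L + S j * d)%nat with (d + L + j * d)%nat by lia.
    change (psum (fun n => g n) L) with (psum g L).
    rewrite <- tech_pow_Rmult. lra.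
Qed.

(** For w = u / 2 this is half the sum of 1 - cos (u n ^ k). *)
Definition sin_energy (k : nat) (w : R) (N : nat) : R :=
  psum (fun n => sin (w * INR n ^ k) ^ 2) N.

Lemma sin_energy_diff (k : nat) (w : R) (d L N : nat) :
  (L + k * d <= N)%nat ->
  INR L * sin (w * INR (fact k) * INR d ^ k) ^ 2 <= 4 ^ k * sin_energy k w N.
Proof.
  intros h. rewrite <- psum_const.
  eapply Rle_trans; [|eapply Rle_trans].
  2: apply (psum_sqr_sin_iter_diff_le w d k L (fun m => INR m ^ k)).
  - apply psum_le; intros n _. rewrite iter_diff_pow, Rmult_assoc. lra.
  - apply Rmult_le_compat_l; [apply pow_le; lra|].
    apply psum_mono; [intros; apply pow2_ge_0|easy].
Qed.

(** As d grows by one, |b| d ^ k grows by a factor at most 2 ^ k, so it cannot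
    jump from the neighbourhood of 0 where it is comparable to its sine to
    another multiple of PI. *)
Lemma sin_small_on_powers (k : nat) (b e : R) (D : nat) :
  Rabs b <= PI / 2 -> 3 * 2 ^ k * e <= PI / 2 ->
  (forall d, (1 <= d <= D)%nat -> Rabs (sin (b * INR d ^ k)) <= e) ->
  (1 <= D)%nat -> Rabs b * INR D ^ k <= 3 * e.
Proof.
  intros Hb He H HD.
  induction D as [|D IH]; [lia|].
  pose proof (H (S D) ltac:(lia)) as HS.
  assert (Hp : 0 <= INR (S D) ^ k) by (apply pow_le, pos_INR).
  assert (Hab : Rabs (b * INR (S D) ^ k) = Rabs b * INR (S D) ^ k).
  { now rewrite Rabs_mult, (Rabs_pos_eq (INR (S D) ^ k)). }
  rewrite <- Hab.
  enough (Hs : Rabs (b * INR (S D) ^ k) <= PI / 2).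
  { pose proof (abs_le_3_abs_sin _ Hs). lra. }
  destruct D as [|D].
  - rewrite Hab. simpl INR. rewrite pow1. lra.
  - rewrite Hab.
    assert (IHD : Rabs b * INR (S D) ^ k <= 3 * e).
    { apply IH; [|lia]. intros d Hd; apply H; lia. }
    apply Rle_trans with (Rabs b * (2 ^ k * INR (S D) ^ k)).
    + apply Rmult_le_compat_l; [apply Rabs_pos|].
      rewrite <- Rpow_mult_distr. apply pow_incr. split; [apply pos_INR|].
      rewrite (S_INR (S D)). assert (1 <= INR (S D)) by (apply (le_INR 1); lia). lra.
    + assert (0 <= 2 ^ k) by (apply pow_le; lra). nra.
Qed.

Lemma pow_congr_1 (q i k : nat) : exists m, ((1 + q * i) ^ k = 1 + q * m)%nat.
Proof.
  induction k as [|k [m IH]]; [exists 0%nat; simpl; lia|].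
  exists (m + i + q * i * m)%nat. rewrite Nat.pow_succ_r', IH. ring.
Qed.

(** If k! w differs from a multiple of PI by b with |b| N ^ k small, then w n^k
    is nearly constant modulo PI along n = 1 (mod k!), so sin w is controlled
    by the average of the energy along this progression. *)
Lemma sqr_sin_le_energy (k N q m : nat) (w r : R) (a : Z) :
  (1 <= q)%nat -> (1 <= m)%nat -> (q * m <= N)%nat ->
  Rabs (w * INR q - IZR a * PI) * INR N ^ k <= r ->
  INR m * sin w ^ 2 <= 2 * (sin_energy k w N + INR m * r ^ 2).
Proof.
  intros Hq Hm HN Hr. set (b := w * INR q - IZR a * PI) in *.
  rewrite <- psum_const, <- (psum_const (r ^ 2)).
  eapply Rle_trans; [apply (psum_le _
    (fun i => 2 * (sin (w * INR (1 + q * (i - 1)) ^ k) ^ 2 + r ^ 2)))|].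
  - intros i Hi. set (n := (1 + q * (i - 1))%nat).
    assert (HnN : (n <= N)%nat) by (unfold n; nia).
    destruct (pow_congr_1 q (i - 1) k) as [m' Hm']. fold n in Hm'.
    pose proof (f_equal INR Hm') as He.
    rewrite pow_INR, plus_INR, mult_INR in He. simpl (INR 1) in He.
    replace (sin w) with (sin (w * INR n ^ k - w * (INR q * INR m')))
      by (f_equal; rewrite He; ring).
    eapply Rle_trans; [apply sqr_sin_minus_le|].
    apply Rmult_le_compat_l; [lra|]. apply Rplus_le_compat_l.
    rewrite <- pow2_abs. apply pow_incr. split; [apply Rabs_pos|].
    replace (w * (INR q * INR m')) with (b * INR m' + IZR (a * Z.of_nat m') * PI)
      by (rewrite mult_IZR, <- INR_IZR_INZ; unfold b; ring).
    rewrite abs_sin_plus_PI_multiple.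
    eapply Rle_trans; [apply abs_sin_le|]. eapply Rle_trans; [|exact Hr].
    rewrite Rabs_mult, (Rabs_pos_eq (INR m')) by apply pos_INR.
    apply Rmult_le_compat_l; [apply Rabs_pos|].
    apply Rle_trans with (INR n ^ k).
    + rewrite He. assert (1 <= INR q) by now apply (le_INR 1).
      pose proof (pos_INR m'). nra.
    + apply pow_incr. split; [apply pos_INR|now apply le_INR].
  - rewrite psum_scal, psum_plus. apply Rmult_le_compat_l; [lra|].
    apply Rplus_le_compat_r.
    eapply Rle_trans.
    + apply (psum_progression_le (fun n => sin (w * INR n ^ k) ^ 2));
        [intros; apply pow2_ge_0|easy].
    + apply psum_mono; [intros; apply pow2_ge_0|easy].
Qed.

(** Weak converse of the obvious bound on the energy: it can be small only if
    w N ^ k is. It plays the part of Weyl's inequality. *)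
Lemma small_energy (k N : nat) (w eta : R) :
  (1 <= k)%nat -> (2 * k <= N)%nat -> (fact k <= N)%nat ->
  Rabs w <= PI / 2 -> 0 <= eta ->
  let A := 6 * (8 * INR k) ^ k in
  6 * INR (fact k) * (INR (fact k) + A) * eta <= 1 ->
  sin_energy k w N <= eta ^ 2 * INR N ->
  Rabs w * INR N ^ k <= A * eta.
Proof.
  intros Hk HN1 HN2 Hw Heta A Hsmall HS.
  set (q := fact k) in *.
  assert (Hq : (1 <= q)%nat) by apply lt_O_fact.
  assert (Hq' : 1 <= INR q) by now apply (le_INR 1).
  assert (Hk' : 1 <= INR k) by now apply (le_INR 1).
  assert (HA : 6 * 4 ^ k <= A).
  { unfold A. apply Rmult_le_compat_l; [lra|]. apply pow_incr. lra. }
  assert (H2k : 1 <= 2 ^ k) by (apply pow_R1_Rle; lra).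
  assert (H4k : 4 ^ k = 2 ^ k * 2 ^ k) by (rewrite <- Rpow_mult_distr; f_equal; lra).
  assert (HAe : A * eta <= 1) by nra.
  pose proof PI2_1 as HPI. pose proof PI_RGT_0 as HPI0.
  (* Differences with step at most D remain inside [1, N] for at least half
     of the starting points. *)
  set (D := (N / (2 * k))%nat).
  pose proof (Nat.div_mod_eq N (2 * k)) as Hdiv.
  pose proof (Nat.mod_upper_bound N (2 * k) ltac:(lia)) as Hmod.
  fold D in Hdiv.
  assert (HD : (1 <= D)%nat) by (apply Nat.div_le_lower_bound; lia).
  assert (HND : INR N <= 4 * INR k * INR D).
  { replace 4 with (INR 4) by (simpl; lra). rewrite <- !mult_INR. apply le_INR. nia. }
  set (e := 2 * 2 ^ k * eta).
  assert (Hdiff : forall d, (1 <= d <= D)%nat ->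
    Rabs (sin (w * INR q * INR d ^ k)) <= e).
  { intros d Hd.
    pose proof (sin_energy_diff k w d (N - k * D) N ltac:(nia)) as H.
    fold q in H.
    assert (HL : INR N <= 2 * INR (N - k * D)).
    { replace 2 with (INR 2) by (simpl; lra). rewrite <- mult_INR. apply le_INR. nia. }
    assert (HN0 : 1 <= INR N) by (apply (le_INR 1); lia).
    set (x := sin (w * INR q * INR d ^ k)) in *.
    assert (Hx : x ^ 2 <= e ^ 2).
    { apply Rmult_le_reg_l with (INR N); [lra|].
      apply Rle_trans with (2 * (4 ^ k * (eta ^ 2 * INR N))).
      - apply Rle_trans with (2 * (INR (N - k * D) * x ^ 2)).
        + pose proof (pow2_ge_0 x). nra.
        + apply Rmult_le_compat_l; [lra|]. eapply Rle_trans; [exact H|].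
          apply Rmult_le_compat_l; [apply pow_le; lra|exact HS].
      - rewrite H4k. unfold e.
        pose proof (pow2_ge_0 (2 ^ k * eta)) as Hs.
        replace (2 * (2 ^ k * 2 ^ k * (eta ^ 2 * INR N)))
          with (INR N * (2 * (2 ^ k * eta) ^ 2)) by ring.
        apply Rmult_le_compat_l; [lra|].
        replace ((2 * 2 ^ k * eta) ^ 2) with (4 * (2 ^ k * eta) ^ 2) by ring. lra. }
    apply Rsqr_incr_0_var; [|unfold e; nra].
    rewrite <- Rsqr_abs. unfold Rsqr. simpl in Hx. lra. }
  assert (HDk : 0 < INR D ^ k) by (apply pow_lt, lt_0_INR; lia).
  assert (Hgrow : forall b, Rabs b <= PI / 2 ->
    (forall d, (1 <= d <= D)%nat -> Rabs (sin (b * INR d ^ k)) <= e) ->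
    Rabs b * INR N ^ k <= A * eta).
  { intros b Hb Hsb.
    pose proof (sin_small_on_powers k b e D Hb ltac:(unfold e; nra) Hsb HD) as H.
    apply Rle_trans with (Rabs b * ((4 * INR k) ^ k * INR D ^ k)).
    - apply Rmult_le_compat_l; [apply Rabs_pos|]. rewrite <- Rpow_mult_distr.
      apply pow_incr. split; [apply pos_INR|easy].
    - apply Rle_trans with ((4 * INR k) ^ k * (3 * e)).
      + replace (Rabs b * ((4 * INR k) ^ k * INR D ^ k))
          with ((4 * INR k) ^ k * (Rabs b * INR D ^ k)) by ring.
        apply Rmult_le_compat_l; [apply pow_le; lra|easy].
      + unfold e, A. replace (8 * INR k) with (2 * (4 * INR k)) by ring.
        rewrite (Rpow_mult_distr 2). lra. }
  destruct (exists_nearest_PI_multiple (w * INR q)) as [a Ha].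
  assert (Hb : Rabs (w * INR q - IZR a * PI) * INR N ^ k <= A * eta).
  { apply Hgrow; [exact Ha|]. intros d Hd.
    rewrite <- (abs_sin_plus_PI_multiple _ (a * Z.of_nat (d ^ k))).
    rewrite mult_IZR, <- INR_IZR_INZ, pow_INR.
    replace ((w * INR q - IZR a * PI) * INR d ^ k + IZR a * INR d ^ k * PI)
      with (w * INR q * INR d ^ k) by ring.
    now apply Hdiff. }
  (* The multiple of PI is in fact 0, since w itself is small. *)
  assert (Hws : Rabs w <= 6 * (INR q + A) * eta).
  { apply Rle_trans with (1 := abs_le_3_abs_sin w Hw).
    enough (Rabs (sin w) <= 2 * (INR q + A) * eta) by lra.
    set (m := (N / q)%nat).
    pose proof (Nat.div_mod_eq N q) as Hdq.
    pose proof (Nat.mod_upper_bound N q ltac:(lia)) as Hmq. fold m in Hdq.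
    assert (Hm : (1 <= m)%nat) by (apply Nat.div_le_lower_bound; lia).
    pose proof (sqr_sin_le_energy k N q m w (A * eta) a Hq Hm ltac:(lia) Hb) as H.
    assert (HNm : INR N <= 2 * INR q * INR m).
    { replace 2 with (INR 2) by (simpl; lra). rewrite <- !mult_INR. apply le_INR. nia. }
    assert (Hm' : 1 <= INR m) by now apply (le_INR 1).
    apply Rsqr_incr_0_var; [|nra]. rewrite <- Rsqr_abs. unfold Rsqr.
    apply Rmult_le_reg_l with (INR m); [lra|].
    replace (sin w * sin w) with (sin w ^ 2) by ring.
    apply Rle_trans with (1 := H).
    apply Rle_trans with (2 * (eta ^ 2 * (2 * INR q * INR m) + INR m * (A * eta) ^ 2)).
    - assert (0 <= eta ^ 2) by apply pow2_ge_0. nra.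
    - replace (2 * (eta ^ 2 * (2 * INR q * INR m) + INR m * (A * eta) ^ 2))
        with (INR m * (eta ^ 2 * (4 * INR q + 2 * A ^ 2))) by ring.
      apply Rmult_le_compat_l; [lra|].
      replace (2 * (INR q + A) * eta * (2 * (INR q + A) * eta))
        with (eta ^ 2 * (4 * (INR q + A) ^ 2)) by ring.
      apply Rmult_le_compat_l; [apply pow2_ge_0|]. nra. }
  apply Rle_trans with (Rabs (w * INR q) * INR N ^ k).
  - apply Rmult_le_compat_r; [apply pow_le, pos_INR|].
    rewrite Rabs_mult, (Rabs_pos_eq (INR q)) by lra.
    pose proof (Rabs_pos w). nra.
  - apply Hgrow; [|exact Hdiff].
    rewrite Rabs_mult, (Rabs_pos_eq (INR q)) by lra.
    apply Rle_trans with (6 * (INR q + A) * eta * INR q); [|lra].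
    apply Rmult_le_compat_r; lra.
Qed.

(** When the energy per term is not small, the claim holds because
    delta <= 1; otherwise small_energy applies. *)
Lemma sin_energy_lower_bound (k : nat) :
  (1 <= k)%nat ->
  exists c, 0 < c /\
  forall (N : nat) (w delta : R), (2 * k <= N)%nat -> (fact k <= N)%nat ->
  Rabs w <= PI / 2 -> 0 <= delta <= 1 -> delta <= Rabs w * INR N ^ k ->
  c * delta ^ 2 * INR N <= sin_energy k w N.
Proof.
  intros Hk.
  set (A := 6 * (8 * INR k) ^ k). set (q := INR (fact k)).
  set (K := 6 * q * (q + A)).
  assert (Hq' : 1 <= q) by apply (le_INR 1), lt_O_fact.
  assert (HA : 0 <= A).
  { unfold A. pose proof (pow_le (8 * INR k) k ltac:(pose proof (pos_INR k); lra)). lra. }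
  assert (HK : A <= K /\ 0 < K) by (unfold K; split; nra).
  exists (/ K ^ 2). split; [apply Rinv_0_lt_compat, pow_lt; lra|].
  intros N w delta HN1 HN2 Hw Hdelta Hdw.
  assert (HN : 1 <= INR N) by (apply (le_INR 1); lia).
  assert (HS : 0 <= sin_energy k w N) by (apply psum_nonneg; intros; apply pow2_ge_0).
  set (eta := sqrt (sin_energy k w N / INR N)).
  assert (Heta : 0 <= eta) by apply sqrt_pos.
  assert (HSe : sin_energy k w N = eta ^ 2 * INR N).
  { unfold eta. rewrite pow2_sqrt by (apply Rdiv_le_0_compat; lra). field; lra. }
  assert (Hde : delta <= K * eta).
  { destruct (Rle_lt_dec (K * eta) 1) as [h|h]; [|lra].
    pose proof (small_energy k N w eta Hk HN1 HN2 Hw Heta h ltac:(lra)) as H.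
    fold A in H. nra. }
  rewrite HSe.
  apply Rmult_le_compat_r; [lra|].
  apply Rmult_le_reg_l with (K ^ 2); [apply pow_lt; lra|].
  rewrite <- Rmult_assoc, Rinv_r, Rmult_1_l by (apply pow_nonzero; lra).
  rewrite <- Rpow_mult_distr. apply pow_incr; lra.
Qed.

(** * Moments of the partial products *)

Lemma is_series_shift (b : nat -> R) (d : nat) (s : R) :
  is_series b s ->
  is_series (fun m => if le_lt_dec d m then b (m - d)%nat else 0) s.
Proof.
  intros H.
  assert (Hp : is_pseries (K := R_AbsRing) (V := R_NormedModule) b 1 s).
  { eapply is_series_ext; [|exact H]. intros n; simpl.
    rewrite pow_n_pow, pow1. unfold scal; simpl; unfold mult; simpl. ring. }
  pose proof (is_pseries_incr_n b d 1 s Hp) as H1.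
  rewrite pow_n_pow, pow1 in H1.
  change (scal 1 s) with (1 * s) in H1. rewrite Rmult_1_l in H1.
  eapply is_series_ext; [|exact H1]. intros n; simpl.
  rewrite pow_n_pow, pow1, PS_incr_n_simplify.
  unfold scal; simpl; unfold mult; simpl. destruct le_lt_dec; [ring|].
  change (@zero R_NormedModule) with 0. ring.
Qed.

(** The two terms correspond to the absence and to the presence of the part
    (N + 1) ^ k. *)
Lemma Q_partial_expectation_S (k N : nat) (t : R) (f : nat -> R) (s1 s2 : R) :
  is_series (fun m => f m * (Q_partial k N m * t ^ m)) s1 ->
  is_series (fun m => f (m + S N ^ k)%nat * (Q_partial k N m * t ^ m)) s2 ->
  is_series (fun m => f m * (Q_partial k (S N) m * t ^ m)) (s1 + t ^ (S N ^ k) * s2).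
Proof.
  intros H1 H2. set (d := (S N ^ k)%nat) in *.
  pose proof (is_series_plus _ _ _ _ H1
    (is_series_scal (t ^ d) _ _ (is_series_shift _ d _ H2))) as H.
  eapply is_series_ext; [|exact H]. intros m; cbv beta.
  rewrite Q_partial_S. fold d.
  unfold plus, scal; simpl; unfold mult; simpl.
  destruct (le_lt_dec d m) as [h|h]; [|ring].
  replace (m - d + d)%nat with m by lia.
  replace (t ^ m) with (t ^ d * t ^ (m - d)) by (rewrite <- pow_add; f_equal; lia).
  ring.
Qed.

(** Probability of the part n ^ k. *)
Definition bern (k : nat) (t : R) (n : nat) : R := t ^ (n ^ k) / (1 + t ^ (n ^ k)).

(** Contributions of the parts 1 ^ k, ..., N ^ k to the mean and the
    variance. *)
Definition mean_upto (k : nat) (t : R) (N : nat) : R :=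
  psum (fun n => INR n ^ k * bern k t n) N.

Definition var_upto (k : nat) (t : R) (N : nat) : R :=
  psum (fun n => (INR n ^ k) ^ 2 * (bern k t n * (1 - bern k t n))) N.

Lemma bern_spec (k n : nat) (t : R) :
  0 <= t -> t ^ (n ^ k) = bern k t n * (1 + t ^ (n ^ k)) /\ 0 <= bern k t n < 1.
Proof.
  intros Ht. pose proof (pow_le t (n ^ k) Ht). unfold bern. split; [field; lra|].
  split; [apply Rdiv_le_0_compat; lra|]. apply Rlt_div_l; lra.
Qed.

Lemma Q_partial_expectation_0 (k : nat) (t : R) (f : nat -> R) :
  is_series (fun m => f m * (Q_partial k 0 m * t ^ m)) (f O).
Proof.
  apply filterlim_ext with (fun _ : nat => f O); [|apply filterlim_const].
  intros n; induction n as [|n IH].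
  - rewrite sum_O; simpl; ring.
  - rewrite sum_Sn, <- IH. simpl. unfold plus; simpl. ring.
Qed.

Lemma Q_partial_first_moment (k N : nat) (t : R) :
  0 <= t ->
  is_series (fun m => INR m * (Q_partial k N m * t ^ m))
    (Q_prod_R k t N * mean_upto k t N).
Proof.
  intros Ht. induction N as [|N IH].
  - replace (Q_prod_R k t 0 * mean_upto k t 0) with (INR 0)
      by (unfold mean_upto; simpl; ring).
    apply (Q_partial_expectation_0 k t INR).
  - set (d := (S N ^ k)%nat).
    assert (Hd : INR d = INR (S N) ^ k) by apply pow_INR.
    pose proof (bern_spec k (S N) t Ht) as [Hb _]. fold d in Hb.
    pose proof (is_series_plus _ _ _ _ IH
      (is_series_scal (INR d) _ _ (Q_partial_is_series_R k N t))) as H.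
    eapply is_series_ext in H; [|intros m; unfold plus, scal; simpl; unfold mult; simpl;
      rewrite <- Rmult_plus_distr_r, <- plus_INR; reflexivity].
    pose proof (Q_partial_expectation_S k N t INR _ _ IH H) as H2.
    match type of H2 with is_series _ ?l =>
      replace (Q_prod_R k t (S N) * mean_upto k t (S N)) with l; [exact H2|] end.
    unfold mean_upto. rewrite psum_S.
    change (Q_prod_R k t (S N)) with (Q_prod_R k t N * (1 + t ^ d)).
    change plus with Rplus. fold d.
    set (x := t ^ d) in *. set (p := bern k t (S N)) in *.
    rewrite <- Hd. set (mu := psum _ N). set (P := Q_prod_R k t N).
    replace (P * (1 + x) * (mu + INR d * p))
      with (P * (1 + x) * mu + P * INR d * (p * (1 + x))) by ring.
    rewrite <- Hb. change (scal (INR d) P) with (INR d * P). ring.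
Qed.

(** The centre c is arbitrary because the induction shifts it when the part
    (N + 1) ^ k is present. *)
Lemma Q_partial_second_moment (k N : nat) (t c : R) :
  0 <= t ->
  is_series (fun m => (INR m - c) ^ 2 * (Q_partial k N m * t ^ m))
    (Q_prod_R k t N * (var_upto k t N + (mean_upto k t N - c) ^ 2)).
Proof.
  intros Ht. revert c; induction N as [|N IH]; intros c.
  - replace (Q_prod_R k t 0 * (var_upto k t 0 + (mean_upto k t 0 - c) ^ 2))
      with ((INR 0 - c) ^ 2)
      by (unfold mean_upto, var_upto; simpl; ring).
    apply (Q_partial_expectation_0 k t (fun m => (INR m - c) ^ 2)).
  - set (d := (S N ^ k)%nat).
    assert (Hd : INR d = INR (S N) ^ k) by apply pow_INR.
    pose proof (bern_spec k (S N) t Ht) as [Hb _]. fold d in Hb.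
    pose proof (IH (c - INR d)) as H.
    eapply is_series_ext in H; [|intros m;
      replace (INR m - (c - INR d)) with (INR (m + d) - c)
        by (rewrite plus_INR; ring); reflexivity].
    pose proof (Q_partial_expectation_S k N t (fun m => (INR m - c) ^ 2)
      _ _ (IH c) H) as H2.
    match type of H2 with is_series _ ?l =>
      match goal with |- is_series _ ?g => replace g with l; [exact H2|] end end.
    unfold mean_upto, var_upto. rewrite !psum_S.
    change (Q_prod_R k t (S N)) with (Q_prod_R k t N * (1 + t ^ d)).
    fold d. set (x := t ^ d) in *. set (p := bern k t (S N)) in *.
    rewrite <- Hd. set (mu := psum (fun n => INR n ^ k * _) N).
    set (V := psum _ N). set (P := Q_prod_R k t N). set (D := INR d).
    assert (Hb1 : 1 = (1 - p) * (1 + x)) by lra.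
    transitivity (P * ((1 - p) * (1 + x)) * (V + (mu - c) ^ 2)
      + p * (1 + x) * (P * (V + (mu - (c - D)) ^ 2))); [|ring].
    rewrite <- Hb1, <- Hb. ring.
Qed.

Lemma is_series_le (a b : nat -> R) (la lb : R) :
  (forall n, a n <= b n) -> is_series a la -> is_series b lb -> la <= lb.
Proof.
  intros H Ha Hb. change (Rbar_le la lb).
  apply is_lim_seq_le with (sum_n a) (sum_n b); [|exact Ha|exact Hb].
  intros n. apply sum_n_m_le, H.
Qed.

(** Monotone convergence: the coefficients of the partial products increase to
    those of the series, and the m-th one is stationary from N = m on. *)
Lemma Q_series_expectation (k : nat) (t l : R) (f F : nat -> R) :
  (1 <= k)%nat -> 0 <= t -> (forall m, 0 <= f m) ->
  (forall N, is_series (fun m => f m * (Q_partial k N m * t ^ m)) (F N)) ->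
  is_lim_seq F l ->
  is_series (fun m => f m * (Q_series k m * t ^ m)) l.
Proof.
  intros Hk Ht Hf HF Hl.
  assert (HtP : forall m, 0 <= t ^ m) by (intros; now apply pow_le).
  assert (Hincr : forall (N : nat) (u : nat -> R), (forall m, 0 <= u m) ->
            sum_n u N <= sum_n u (S N)).
  { intros N u Hu. rewrite sum_Sn. change plus with Rplus.
    pose proof (Hu (S N)); lra. }
  set (part := sum_n (fun m => f m * (Q_series k m * t ^ m))).
  assert (HSF : forall M, part M <= F M).
  { intros M. unfold part.
    rewrite (sum_n_ext_loc _ (fun m => f m * (Q_partial k M m * t ^ m))).
    2:{ intros n Hn. rewrite <- (Q_partial_eq k n (M - n)) by easy.
        now replace (n + (M - n))%nat with M by lia. }
    apply (is_lim_seq_incr_compare (sum_n (fun m => f m * (Q_partial k M m * t ^ m)))).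
    - apply HF.
    - intros n; apply Hincr; intros m.
      apply Rmult_le_pos; [easy|]. apply Rmult_le_pos; [apply Q_partial_ge_0|easy]. }
  assert (HFincr : forall N, F N <= F (S N)).
  { intros N. apply is_series_le with (2 := HF N) (3 := HF (S N)). intros m.
    apply Rmult_le_compat_l; [easy|]. apply Rmult_le_compat_r; [easy|].
    apply Q_partial_incr. }
  assert (HFl : forall N, F N <= l) by (now apply is_lim_seq_incr_compare).
  assert (HSincr : forall n, part n <= part (S n)).
  { intros n; apply Hincr; intros m.
    apply Rmult_le_pos; [easy|]. apply Rmult_le_pos; [apply Q_partial_ge_0|easy]. }
  destruct (ex_finite_lim_seq_incr part l HSincr) as [s Hs].
  { intros n; eapply Rle_trans; [apply HSF|apply HFl]. }
  replace l with s; [exact Hs|].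
  apply Rle_antisym.
  - apply (is_lim_seq_le _ _ _ _ (fun n => Rle_trans _ _ _ (HSF n) (HFl n)) Hs
      (is_lim_seq_const l)).
  - apply (is_lim_seq_le F (fun _ => s) l s); [|easy|apply is_lim_seq_const].
    intros N. apply is_series_le with (2 := HF N) (3 := Hs). intros m.
    apply Rmult_le_compat_l; [easy|]. apply Rmult_le_compat_r; [easy|].
    now apply Q_partial_le.
Qed.

(** * Radius of convergence, mean and variance *)

Lemma Q_partial_at_0 (k N : nat) : 1 <= Q_partial k N 0.
Proof.
  induction N as [|N IH]; [simpl; lra|]. pose proof (Q_partial_incr k N 0). lra.
Qed.

Lemma Q_series_at_pow (k n : nat) : (1 <= k)%nat -> (1 <= n)%nat -> 1 <= Q_series k (n ^ k).
Proof.
  intros Hk Hn. destruct n as [|n]; [lia|].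
  apply Rle_trans with (2 := Q_partial_le k (S n) _ Hk).
  rewrite Q_partial_S. destruct le_lt_dec as [h|h]; [|lia].
  rewrite Nat.sub_diag. pose proof (Q_partial_at_0 k n).
  pose proof (Q_partial_ge_0 k n (S n ^ k)). lra.
Qed.

(** The coefficients at the k-th powers are at least 1, so the series diverges
    at 1. *)
Lemma CV_radius_Q (k : nat) : (1 <= k)%nat -> CV_radius (Q_series k) = 1.
Proof.
  intros Hk. apply Rbar_le_antisym.
  - apply Rbar_not_lt_le. intros H.
    assert (H0 : is_lim_seq (fun n => Q_series k n * 1 ^ n) 0).
    { apply ex_series_lim_0, ex_series_Rabs, CV_disk_inside.
      now rewrite Rabs_pos_eq by lra. }
    apply is_lim_seq_spec in H0. destruct (H0 (mkposreal 1 Rlt_0_1)) as [N HN]. simpl in HN.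
    specialize (HN (S N ^ k)%nat).
    pose proof (le_pow_k k (S N) ltac:(lia) Hk).
    specialize (HN ltac:(lia)). rewrite pow1 in HN.
    pose proof (Q_series_at_pow k (S N) Hk ltac:(lia)).
    apply Rabs_def2 in HN. lra.
  - assert (H : forall r, 0 <= r < 1 -> Rbar_le r (CV_radius (Q_series k))).
    { intros r Hr. apply Rbar_not_lt_le. intros H.
      apply (CV_disk_outside (Q_series k) r).
      - now rewrite Rabs_pos_eq by lra.
      - destruct (Q_series_is_series_R k r Hk Hr) as [s [Hs _]].
        apply ex_series_lim_0. now exists s. }
    destruct (CV_radius (Q_series k)) as [c| |]; simpl.
    + destruct (Rle_lt_dec 1 c) as [h|h]; [easy|].
      pose proof (H 0 ltac:(lra)) as Hc. simpl in Hc.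
      specialize (H ((c + 1) / 2) ltac:(lra)). simpl in H. lra.
    + easy.
    + exact (H 0 ltac:(lra)).
Qed.

Lemma in_K_Q (k : nat) : (1 <= k)%nat -> in_K (Q_series k).
Proof.
  intros Hk. repeat split.
  - intros n. apply Q_partial_ge_0.
  - pose proof (Q_partial_at_0 k 0). unfold Q_series. lra.
  - exists 1%nat. split; [lia|].
    pose proof (Q_series_at_pow k 1 Hk ltac:(lia)) as H. rewrite Nat.pow_1_l in H. lra.
  - rewrite CV_radius_Q by easy. simpl; lra.
Qed.

Lemma Q_prod_R_ge_1 (k N : nat) (t : R) : 0 <= t -> 1 <= Q_prod_R k t N.
Proof.
  intros Ht. induction N as [|N IH]; [simpl; lra|].
  change (Q_prod_R k t (S N)) with (Q_prod_R k t N * (1 + t ^ (S N ^ k))).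
  pose proof (pow_le t (S N ^ k) Ht). nra.
Qed.

Lemma PSeries_Q (k : nat) (t : R) :
  (1 <= k)%nat -> 0 <= t < 1 ->
  is_lim_seq (Q_prod_R k t) (PSeries (Q_series k) t) /\ 1 <= PSeries (Q_series k) t.
Proof.
  intros Hk Ht. destruct (Q_series_is_series_R k t Hk Ht) as [s [Hs HP]].
  replace (PSeries (Q_series k) t) with s by (symmetry; now apply is_series_unique).
  split; [easy|].
  apply (is_lim_seq_le (fun _ => 1) (Q_prod_R k t) 1 s); [|apply is_lim_seq_const|easy].
  intros n. apply Q_prod_R_ge_1; lra.
Qed.

Lemma khinchin_E_eq (a : nat -> R) (t l : R) (f : nat -> R) :
  PSeries a t <> 0 ->
  is_series (fun m => f m * (a m * t ^ m)) (PSeries a t * l) ->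
  khinchin_E a t f = l.
Proof.
  intros HP H. apply is_series_unique.
  apply (is_series_scal (/ PSeries a t)) in H.
  replace l with (scal (/ PSeries a t) (PSeries a t * l))
    by (unfold scal; simpl; unfold mult; simpl; field; easy).
  eapply is_series_ext; [|exact H]. intros m.
  unfold khinchin_law, scal; simpl; unfold mult; simpl. field; easy.
Qed.

Lemma khinchin_mean_Q (k : nat) (t mu : R) :
  (1 <= k)%nat -> 0 <= t < 1 -> is_lim_seq (mean_upto k t) mu ->
  khinchin_mean (Q_series k) t = mu.
Proof.
  intros Hk Ht Hmu. destruct (PSeries_Q k t Hk Ht) as [HP HP1].
  apply khinchin_E_eq; [lra|].
  apply Q_series_expectation with (fun N => Q_prod_R k t N * mean_upto k t N);
    [easy|lra|apply pos_INR|intros N; apply Q_partial_first_moment; lra|].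
  now apply (is_lim_seq_mult' (Q_prod_R k t) (mean_upto k t)).
Qed.

Lemma khinchin_var_Q (k : nat) (t mu V : R) :
  (1 <= k)%nat -> 0 <= t < 1 -> is_lim_seq (mean_upto k t) mu ->
  is_lim_seq (var_upto k t) V ->
  khinchin_var (Q_series k) t = V.
Proof.
  intros Hk Ht Hmu HV. destruct (PSeries_Q k t Hk Ht) as [HP HP1].
  unfold khinchin_var. rewrite (khinchin_mean_Q k t mu) by easy.
  apply khinchin_E_eq; [lra|].
  apply Q_series_expectation with
    (fun N => Q_prod_R k t N * (var_upto k t N + (mean_upto k t N - mu) ^ 2));
    [easy|lra|intros; apply pow2_ge_0|intros N; apply Q_partial_second_moment; lra|].
  replace V with (V + (mu - mu) * ((mu - mu) * 1)) by ring.
  apply (is_lim_seq_mult' (Q_prod_R k t)); [easy|].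
  assert (H : is_lim_seq (fun N => mean_upto k t N - mu) (mu - mu)).
  { apply is_lim_seq_minus'; [easy|apply is_lim_seq_const]. }
  apply is_lim_seq_plus'; [easy|].
  apply is_lim_seq_mult'; [easy|].
  apply is_lim_seq_mult'; [easy|apply is_lim_seq_const].
Qed.

(** * The characteristic function as an infinite product *)

Definition expi (x : R) : C := (cos x, sin x).

Lemma expi_plus (x y : R) : expi (x + y) = (expi x * expi y)%C.
Proof.
  unfold expi, Cmult; simpl. rewrite cos_plus, sin_plus. f_equal; ring.
Qed.

Lemma expi_0 : expi 0 = RtoC 1.
Proof. unfold expi. now rewrite cos_0, sin_0. Qed.

Lemma Cmod_expi (x : R) : Cmod (expi x) = 1.
Proof.
  unfold Cmod. replace (fst (expi x) ^ 2 + snd (expi x) ^ 2) with 1; [apply sqrt_1|].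
  simpl. pose proof (sin2_cos2 x) as H. unfold Rsqr in H. lra.
Qed.

Lemma expi_pow (x : R) (n : nat) : (expi x ^ n)%C = expi (INR n * x).
Proof.
  induction n as [|n IH].
  - simpl. now rewrite Rmult_0_l, expi_0.
  - rewrite S_INR, Rmult_plus_distr_r, Rmult_1_l, expi_plus.
    simpl. rewrite IH. ring.
Qed.

(** Componentwise, so that the limit theorems for real sequences apply. *)
Definition Clim (F : nat -> C) (l : C) : Prop :=
  is_lim_seq (fun n => fst (F n)) (fst l) /\ is_lim_seq (fun n => snd (F n)) (snd l).

Lemma Clim_filterlim (F : nat -> C) (l : C) :
  filterlim F eventually (locally l) -> Clim F l.
Proof.
  intros H. split; intros P [eps HP]; unfold filtermap.
  - apply (H (fun z : C => P (fst z))). exists eps. intros z [Hz _]. now apply HP.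
  - apply (H (fun z : C => P (snd z))). exists eps. intros z [_ Hz]. now apply HP.
Qed.

Lemma Clim_ext (F G : nat -> C) (l : C) : (forall n, F n = G n) -> Clim F l -> Clim G l.
Proof.
  intros H [H1 H2]. split.
  - eapply is_lim_seq_ext; [|exact H1]. intros n; cbv beta; now rewrite <- (H n).
  - eapply is_lim_seq_ext; [|exact H2]. intros n; cbv beta; now rewrite <- (H n).
Qed.

Lemma Clim_mult (F G : nat -> C) (l m : C) :
  Clim F l -> Clim G m -> Clim (fun n => F n * G n)%C (l * m)%C.
Proof.
  intros [F1 F2] [G1 G2]. split; simpl.
  - apply is_lim_seq_minus'; now apply is_lim_seq_mult'.
  - apply is_lim_seq_plus'; now apply is_lim_seq_mult'.
Qed.

Lemma Clim_minus (F G : nat -> C) (l m : C) :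
  Clim F l -> Clim G m -> Clim (fun n => F n - G n)%C (l - m)%C.
Proof.
  intros [F1 F2] [G1 G2]. split; simpl; now apply is_lim_seq_minus'.
Qed.

Lemma Clim_RtoC (f : nat -> R) (l : R) : is_lim_seq f l -> Clim (fun n => RtoC (f n)) (RtoC l).
Proof. intros H. split; simpl; [easy|apply is_lim_seq_const]. Qed.

Lemma Clim_expi (f : nat -> R) (l : R) : is_lim_seq f l -> Clim (fun n => expi (f n)) (expi l).
Proof.
  intros H. split; simpl; apply is_lim_seq_continuous; try easy;
    [apply continuity_cos|apply continuity_sin].
Qed.

Lemma Cmod_Clim_le (F : nat -> C) (l : C) (b : R) :
  Clim F l -> eventually (fun n => Cmod (F n) <= b) -> Cmod l <= b.
Proof.
  intros [H1 H2] Hb. change (Rbar_le (Cmod l) b).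
  apply is_lim_seq_le_loc with (fun n => Cmod (F n)) (fun _ => b);
    [easy| |apply is_lim_seq_const].
  unfold Cmod. apply (is_lim_seq_continuous sqrt).
  - apply continuity_pt_sqrt. pose proof (pow2_ge_0 (fst l)). pose proof (pow2_ge_0 (snd l)). lra.
  - apply is_lim_seq_plus'; simpl; apply is_lim_seq_mult'; try easy;
      apply is_lim_seq_mult'; try easy; apply is_lim_seq_const.
Qed.

Fixpoint cprod (F : nat -> C) (N : nat) : C :=
  match N with
  | O => RtoC 1
  | S N' => (cprod F N' * F N)%C
  end.

(** Characteristic function at v of B - p, for B a Bernoulli variable of
    parameter p. *)
Definition bern_charfun (p v : R) : C := ((RtoC (1 - p) + RtoC p * expi v) * expi (- (p * v)))%C.

Definition Q_factor (k : nat) (t u : R) (n : nat) : C :=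
  bern_charfun (bern k t n) (u * INR n ^ k).

Lemma cprod_Q_factor (k N : nat) (t u : R) :
  0 <= t ->
  (Q_prod k (RtoC t * expi u)%C N * expi (- (u * mean_upto k t N)))%C
  = (RtoC (Q_prod_R k t N) * cprod (Q_factor k t u) N)%C.
Proof.
  intros Ht. induction N as [|N IH].
  - simpl. unfold mean_upto; simpl. rewrite Rmult_0_r, Ropp_0, expi_0. ring.
  - unfold mean_upto in *. rewrite psum_S.
    change (Q_prod k (RtoC t * expi u) (S N))%C with
      (Q_prod k (RtoC t * expi u) N * (RtoC 1 + (RtoC t * expi u) ^ (S N ^ k)))%C.
    change (Q_prod_R k t (S N)) with (Q_prod_R k t N * (1 + t ^ (S N ^ k))).
    change (cprod (Q_factor k t u) (S N)) with
      (cprod (Q_factor k t u) N * Q_factor k t u (S N))%C.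
    set (mu := psum _ N) in *.
    unfold Q_factor at 2. unfold bern_charfun.
    pose proof (bern_spec k (S N) t Ht) as [Hb _].
    rewrite Cpow_mult_l, <- RtoC_pow, expi_pow, pow_INR.
    set (p := bern k t (S N)) in *. set (x := t ^ (S N ^ k)) in *.
    set (b := INR (S N) ^ k).
    replace (- (u * (mu + b * p))) with (- (u * mu) + - (p * (u * b))) by ring.
    rewrite expi_plus, (Rmult_comm b u).
    assert (H1 : (RtoC 1 + RtoC x * expi (u * b)
              = RtoC (1 + x) * (RtoC (1 - p) + RtoC p * expi (u * b)))%C).
    { rewrite Cmult_plus_distr_l, Cmult_assoc, <- !RtoC_mult.
      f_equal; [|f_equal]; f_equal; lra. }
    rewrite H1, RtoC_mult.
    transitivity ((Q_prod k (RtoC t * expi u) N * expi (- (u * mu))) *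
      (RtoC (1 + x) * ((RtoC (1 - p) + RtoC p * expi (u * b)) * expi (- (p * (u * b))))))%C;
      [ring|]. rewrite IH. ring.
Qed.

(** The characteristic function is an infinite product, by independence of the
    indicator variables of the parts. *)
Lemma khinchin_charfun_Q (k : nat) (t mu theta : R) :
  (1 <= k)%nat -> 0 <= t < 1 -> is_lim_seq (mean_upto k t) mu ->
  Clim (cprod (Q_factor k t (theta / khinchin_sigma (Q_series k) t)))
    (khinchin_charfun (Q_series k) t theta).
Proof.
  intros Hk Ht Hmu. set (u := theta / _).
  set (z := (RtoC t * expi u)%C).
  destruct (PSeries_Q k t Hk Ht) as [HP HP1].
  set (P := PSeries (Q_series k) t) in *.
  assert (Hz : Cmod z < 1).
  { unfold z. rewrite Cmod_mult, Cmod_R, Cmod_expi, Rabs_pos_eq; lra. }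
  destruct (Q_series_product k z Hk Hz) as [l [Hl HQ]].
  apply Clim_filterlim in HQ.
  assert (Hlim : Clim (fun N => RtoC (/ Q_prod_R k t N) *
      (Q_prod k z N * expi (- (u * mean_upto k t N))))%C
      (RtoC (/ P) * (l * expi (- (u * mu))))%C).
  { apply Clim_mult; [|apply Clim_mult; [easy|]].
    - apply Clim_RtoC. apply (is_lim_seq_inv _ P HP). intros E; injection E; lra.
    - apply Clim_expi. apply (is_lim_seq_opp _ (u * mu)).
      now apply (is_lim_seq_scal_l (mean_upto k t) u mu). }
  replace (khinchin_charfun (Q_series k) t theta)
    with (RtoC (/ P) * (l * expi (- (u * mu))))%C.
  - eapply Clim_ext; [|exact Hlim]. intros N. cbv beta. unfold z.
    rewrite cprod_Q_factor, Cmult_assoc, <- RtoC_mult, Rinv_l, Cmult_1_l;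
      [easy| |lra].
    pose proof (Q_prod_R_ge_1 k N t ltac:(lra)). lra.
  - apply Clim_filterlim in Hl. destruct Hl as [Hl1 Hl2].
    assert (Hterm : forall m, (RtoC (Q_series k m) * z ^ m)%C =
        (Q_series k m * t ^ m * cos (INR m * u), Q_series k m * t ^ m * sin (INR m * u))).
    { intros m. unfold z. rewrite Cpow_mult_l, <- RtoC_pow, expi_pow.
      unfold expi, Cmult, RtoC; simpl. f_equal; ring. }
    assert (Hs1 : is_series (fun m => Q_series k m * t ^ m * cos (INR m * u)) (fst l)).
    { change (is_lim_seq (sum_n (fun m => Q_series k m * t ^ m * cos (INR m * u))) (fst l)).
      eapply is_lim_seq_ext; [|exact Hl1]. intros N; induction N as [|N IH].
      - rewrite !sum_O, Hterm. reflexivity.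
      - rewrite !sum_Sn, <- IH, Hterm. reflexivity. }
    assert (Hs2 : is_series (fun m => Q_series k m * t ^ m * sin (INR m * u)) (snd l)).
    { change (is_lim_seq (sum_n (fun m => Q_series k m * t ^ m * sin (INR m * u))) (snd l)).
      eapply is_lim_seq_ext; [|exact Hl2]. intros N; induction N as [|N IH].
      - rewrite !sum_O, Hterm. reflexivity.
      - rewrite !sum_Sn, <- IH, Hterm. reflexivity. }
    assert (Harg : forall m, theta * khinchin_normalized (Q_series k) t m
                      = INR m * u - u * mu).
    { intros m. unfold khinchin_normalized, u. rewrite (khinchin_mean_Q k t mu) by easy.
      unfold Rdiv. ring. }
    unfold khinchin_charfun, expi. rewrite cos_neg, sin_neg.
    unfold Cmult, RtoC; simpl. symmetry. f_equal; apply khinchin_E_eq.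
    1, 3: fold P; lra.
    + fold P.
      pose proof (is_series_plus _ _ _ _ (is_series_scal (cos (u * mu)) _ _ Hs1)
        (is_series_scal (sin (u * mu)) _ _ Hs2)) as H.
      match type of H with is_series _ ?x => match goal with |- is_series _ ?y =>
        replace y with x end end.
      * eapply is_series_ext; [|exact H]. intros m. rewrite Harg, cos_minus.
        unfold plus, scal; simpl; unfold mult; simpl. ring.
      * unfold plus, scal; simpl; unfold mult; simpl. field; lra.
    + fold P.
      pose proof (is_series_minus _ _ _ _ (is_series_scal (cos (u * mu)) _ _ Hs2)
        (is_series_scal (sin (u * mu)) _ _ Hs1)) as H.
      match type of H with is_series _ ?x => match goal with |- is_series _ ?y =>
        replace y with x end end.
      * eapply is_series_ext; [|exact H]. intros m. rewrite Harg, sin_minus.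
        unfold plus, opp, scal; simpl; unfold mult; simpl. ring.
      * unfold plus, opp, scal; simpl; unfold mult; simpl. field; lra.
Qed.

(** * Estimates for the factors and their sums *)

Lemma Cmod_le_abs_plus_abs (z : C) : Cmod z <= Rabs (fst z) + Rabs (snd z).
Proof.
  pose proof (Rabs_pos (fst z)). pose proof (Rabs_pos (snd z)).
  unfold Cmod. rewrite <- (pow2_abs (fst z)), <- (pow2_abs (snd z)).
  rewrite <- (sqrt_pow2 (Rabs (fst z) + Rabs (snd z))) by lra.
  apply sqrt_le_1_alt. nra.
Qed.

Lemma expi_taylor (x : R) : Cmod (expi x - ((1 - x ^ 2 / 2)%R, x))%C <= Rabs x ^ 3.
Proof.
  eapply Rle_trans; [apply Cmod_le_abs_plus_abs|]. simpl fst; simpl snd.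
  pose proof (cos_taylor x) as H1. pose proof (sin_taylor x) as H2.
  replace (cos x + - (1 - x * (x * 1) / 2)) with (cos x - 1 + x ^ 2 / 2) by field.
  unfold Rminus in H2.
  assert (0 <= Rabs x ^ 3) by (apply pow_le, Rabs_pos). lra.
Qed.

(** The first-order terms cancel because the variable is centred. *)
Lemma bern_charfun_taylor (p v : R) :
  0 <= p <= 1 ->
  Cmod (bern_charfun p v - RtoC (1 - v ^ 2 * (p * (1 - p)) / 2))%C
  <= Rabs v ^ 3 * (p * (1 - p)).
Proof.
  intros Hp.
  assert (HE : forall x y, 0 <= x <= 1 -> Rabs y ^ 3 * x ^ 3 = Rabs (x * y) ^ 3).
  { intros x y Hx. rewrite Rabs_mult, (Rabs_pos_eq x) by lra. ring. }
  pose proof (expi_taylor (- (p * v))) as H1.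
  pose proof (expi_taylor ((1 - p) * v)) as H2.
  rewrite Rabs_Ropp, <- HE in H1 by lra. rewrite <- HE in H2 by lra.
  set (A1 := (expi (- (p * v)) - _)%C) in H1.
  set (A2 := (expi ((1 - p) * v) - _)%C) in H2.
  replace (bern_charfun p v - _)%C with (RtoC (1 - p) * A1 + RtoC p * A2)%C.
  - eapply Rle_trans; [apply Cmod_triangle|].
    rewrite !Cmod_mult, !Cmod_R, !Rabs_pos_eq by lra.
    assert (Hv : 0 <= Rabs v ^ 3) by (apply pow_le, Rabs_pos).
    apply Rle_trans with ((1 - p) * (Rabs v ^ 3 * p ^ 3) + p * (Rabs v ^ 3 * (1 - p) ^ 3)).
    + apply Rplus_le_compat; apply Rmult_le_compat_l; lra.
    + replace (_ + _) with (Rabs v ^ 3 * (p * (1 - p) * (1 - 2 * (p * (1 - p))))) by ring.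
      apply Rmult_le_compat_l; [easy|].
      pose proof (pow2_ge_0 (p * (1 - p))). lra.
  - assert (HB : bern_charfun p v =
      (RtoC (1 - p) * expi (- (p * v)) + RtoC p * expi ((1 - p) * v))%C).
    { unfold bern_charfun. replace ((1 - p) * v) with (v + - (p * v)) by ring.
      rewrite (expi_plus v). ring. }
    rewrite HB. unfold A1, A2.
    unfold Cminus, Cplus, Cmult, Copp, RtoC; simpl. f_equal; field.
Qed.

Lemma exp_opp_bounds (w : R) : 0 <= w -> 0 <= exp (- w) - 1 + w <= w ^ 2.
Proof.
  intros Hw. split; [pose proof (exp_ineq1_le (- w)); lra|].
  pose proof (exp_ineq1_le w).
  assert (exp (- w) <= / (1 + w)).
  { rewrite exp_Ropp. apply Rinv_le_contravar; lra. }
  assert (/ (1 + w) <= 1 - w + w ^ 2).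
  { apply Rmult_le_reg_l with (1 + w); [lra|]. rewrite Rinv_r by lra.
    assert (0 <= w ^ 3) by (apply pow_le; lra).
    replace ((1 + w) * (1 - w + w ^ 2)) with (1 + w ^ 3) by ring. lra. }
  lra.
Qed.

(** A relative error, unlike that of bern_charfun_taylor: the bounds on v keep
    the Gaussian factor exp (v ^ 2 p (1 - p) / 2) below exp 2 <= 9. *)
Lemma bern_charfun_gaussian (p v : R) :
  0 <= p <= 1 -> v ^ 2 * (p * (1 - p)) <= 4 -> Rabs v * (p * (1 - p)) <= 1 ->
  Cmod (bern_charfun p v * RtoC (exp (v ^ 2 * (p * (1 - p)) / 2)) - RtoC 1)%C
  <= 12 * (Rabs v ^ 3 * (p * (1 - p))).
Proof.
  intros Hp H4 H1.
  pose proof (bern_charfun_taylor p v Hp) as HT.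
  set (a := p * (1 - p)) in *. assert (Ha : 0 <= a) by (unfold a; nra).
  set (w := v ^ 2 * a / 2) in *.
  pose proof (pow2_ge_0 v) as Hv2.
  assert (Hw : 0 <= w) by (unfold w; nra).
  assert (Hww : w ^ 2 <= Rabs v ^ 3 * a / 4).
  { unfold w. rewrite <- (pow2_abs v).
    replace ((Rabs v ^ 2 * a / 2) ^ 2) with (Rabs v ^ 3 * a / 4 * (Rabs v * a)) by field.
    assert (0 <= Rabs v ^ 3 * a) by (apply Rmult_le_pos; [apply pow_le, Rabs_pos|easy]).
    rewrite <- (Rmult_1_r (Rabs v ^ 3 * a / 4)) at 2.
    apply Rmult_le_compat_l; lra. }
  pose proof (exp_opp_bounds w Hw) as He.
  assert (Hew : exp w <= 9).
  { apply Rle_trans with (exp (1 + 1)); [apply exp_incr; unfold w; lra|].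
    rewrite exp_plus. pose proof exp_le_3. pose proof (exp_pos 1). nra. }
  assert (Hexp : exp w * exp (- w) = 1) by (rewrite <- exp_plus, Rplus_opp_r; apply exp_0).
  pose proof (exp_pos w).
  replace (bern_charfun p v * RtoC (exp w) - RtoC 1)%C
    with (RtoC (exp w) * ((bern_charfun p v - RtoC (1 - w)) - RtoC (exp (- w) - 1 + w)))%C.
  - rewrite Cmod_mult, Cmod_R, Rabs_pos_eq by lra.
    apply Rle_trans with (9 * (Rabs v ^ 3 * a + Rabs v ^ 3 * a / 4)).
    + apply Rmult_le_compat; [lra|apply Cmod_ge_0|easy|].
      eapply Rle_trans; [apply Cmod_triangle|].
      rewrite Cmod_opp, Cmod_R, (Rabs_pos_eq (exp (- w) - 1 + w)) by lra. lra.
    + assert (0 <= Rabs v ^ 3 * a) by (apply Rmult_le_pos; [apply pow_le, Rabs_pos|easy]).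
      lra.
  - transitivity (bern_charfun p v * RtoC (exp w) - RtoC (exp w * exp (- w)))%C;
      [|now rewrite Hexp].
    unfold Cminus, Cplus, Cmult, Copp, RtoC; simpl. f_equal; ring.
Qed.

Lemma Cmod_cprod_minus_1 (F : nat -> C) (e : nat -> R) (N : nat) :
  (forall n, Cmod (F n - RtoC 1)%C <= e n) ->
  Cmod (cprod F N - RtoC 1)%C <= exp (psum e N) - 1.
Proof.
  intros H. induction N as [|N IH].
  - simpl. replace (RtoC 1 - RtoC 1)%C with (RtoC 0) by ring.
    rewrite Cmod_0, exp_0. lra.
  - rewrite psum_S, exp_plus. simpl cprod.
    set (b := F (S N)). pose proof (H (S N)) as Hb. fold b in Hb.
    set (x := e (S N)) in *. set (E := exp (psum e N)) in *.
    replace (cprod F N * b - RtoC 1)%C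
      with ((cprod F N - RtoC 1) * (RtoC 1 + (b - RtoC 1)) + (b - RtoC 1))%C by ring.
    eapply Rle_trans; [apply Cmod_triangle|]. rewrite Cmod_mult.
    pose proof (Cmod_triangle (RtoC 1) (b - RtoC 1)) as Ht. rewrite Cmod_1 in Ht.
    pose proof (Cmod_ge_0 (b - RtoC 1)). pose proof (exp_ineq1_le x).
    assert (0 < E) by apply exp_pos.
    apply Rle_trans with ((E - 1) * (1 + x) + x).
    + apply Rplus_le_compat; [|easy].
      apply Rmult_le_compat; [apply Cmod_ge_0|apply Cmod_ge_0|easy|lra].
    + nra.
Qed.

(** The squared modulus is exactly 1 - 4 p (1 - p) sin (v / 2) ^ 2. *)
Lemma Cmod_bern_charfun_le (p v : R) :
  0 <= p <= 1 ->
  Cmod (bern_charfun p v) <= exp (- (2 * (p * (1 - p)) * sin (v / 2) ^ 2)).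
Proof.
  intros Hp. unfold bern_charfun. rewrite Cmod_mult, Cmod_expi, Rmult_1_r.
  set (y := 2 * (p * (1 - p)) * sin (v / 2) ^ 2).
  rewrite <- (sqrt_pow2 (exp (- y))) by apply Rlt_le, exp_pos.
  apply sqrt_le_1_alt.
  replace (exp (- y) ^ 2) with (exp (- (2 * y))).
  2:{ replace (- (2 * y)) with (- y + - y) by ring. rewrite exp_plus. ring. }
  apply Rle_trans with (1 + - (2 * y)); [|apply exp_ineq1_le].
  right. simpl. unfold y.
  pose proof (sin2_cos2 v) as H1. unfold Rsqr in H1.
  assert (Hc : cos v = 1 - 2 * sin (v / 2) * sin (v / 2)).
  { rewrite <- cos_2a_sin. f_equal. field. }
  transitivity ((1 - p) ^ 2 + 2 * (1 - p) * p * cos v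
    + p ^ 2 * (sin v * sin v + cos v * cos v)); [ring|].
  rewrite H1, Hc. ring.
Qed.

Lemma Cmod_cprod_le (F : nat -> C) (g : nat -> R) (N : nat) :
  (forall n, Cmod (F n) <= exp (- g n)) -> Cmod (cprod F N) <= exp (- psum g N).
Proof.
  intros H. induction N as [|N IH].
  - simpl. rewrite Cmod_1, Ropp_0, exp_0. lra.
  - rewrite psum_S, Ropp_plus_distr, exp_plus. simpl cprod. rewrite Cmod_mult.
    apply Rmult_le_compat; try apply Cmod_ge_0; [easy|apply H].
Qed.

Lemma cprod_mult_exp (F : nat -> C) (g : nat -> R) (N : nat) :
  (cprod F N * RtoC (exp (psum g N)))%C = cprod (fun n => F n * RtoC (exp (g n)))%C N.
Proof.
  induction N as [|N IH]; [simpl; rewrite exp_0; ring|].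
  rewrite psum_S, exp_plus, RtoC_mult. simpl cprod. rewrite <- IH. ring.
Qed.

(** The terms are of size N ^ (3 k) up to n = N, and decay at least like
    (N / n) ^ 2 beyond; comparison with the telescoping series of
    1 / (N + n - 1) - 1 / (N + n) treats both ranges at once. *)
Lemma psum_cubic_exp_le (k N : nat) (s K : R) :
  (1 <= k)%nat -> (1 <= N)%nat -> 0 < s -> 1 <= K * (s * INR N ^ k) ->
  forall L, psum (fun n => (INR n ^ k) ^ 3 * exp (- (s * INR n ^ k))) L
    <= K ^ 3 * (108 + 6250 * K ^ 2) * (INR N ^ k) ^ 3 * INR N.
Proof.
  intros Hk HN Hs HK L.
  set (X := INR N) in *. assert (HX : 1 <= X) by (apply (le_INR 1); lia).
  assert (HXk : 1 <= X ^ k) by (apply pow_R1_Rle; lra).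
  assert (HK0 : 0 < K) by (assert (0 < s * X ^ k) by nra; nra).
  set (C0 := K ^ 3 * (108 + 6250 * K ^ 2) * (X ^ k) ^ 3).
  assert (HC0 : 0 <= C0).
  { unfold C0. assert (0 <= K ^ 3) by (apply pow_le; lra).
    assert (0 <= K ^ 2) by (apply pow_le; lra).
    assert (0 <= (X ^ k) ^ 3) by (apply pow_le; lra).
    apply Rmult_le_pos; [|easy]. apply Rmult_le_pos; [easy|lra]. }
  assert (Hterm : forall n, (1 <= n)%nat ->
    (INR n ^ k) ^ 3 * exp (- (s * INR n ^ k)) * (X + INR n) ^ 2 <= C0 * X ^ 2).
  { intros n Hn. set (z := INR n). assert (Hz : 1 <= z) by now apply (le_INR 1).
    assert (Hzk : 1 <= z ^ k) by (apply pow_R1_Rle; lra).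
    set (y := s * z ^ k). assert (Hy : 0 <= y) by (unfold y; nra).
    assert (Hzy : z ^ k <= K * X ^ k * y).
    { unfold y. replace (K * X ^ k * (s * z ^ k)) with (z ^ k * (K * (s * X ^ k))) by ring.
      nra. }
    assert (Hz2 : z ^ 2 <= X ^ 2 * (1 + (K * y) ^ 2)).
    { destruct (Rle_lt_dec z X) as [h|h].
      - pose proof (pow_incr z X 2 ltac:(lra)). pose proof (pow2_ge_0 X).
        pose proof (pow2_ge_0 (K * y)). nra.
      - (* z / X <= (z / X) ^ k since z >= X and k >= 1. *)
        assert (Hr : z <= X * (K * y)).
        { apply Rmult_le_reg_r with (X ^ (k - 1)); [apply pow_lt; lra|].
          replace (X * (K * y) * X ^ (k - 1)) with (K * X ^ k * y).
          - apply Rle_trans with (2 := Hzy).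
            apply Rle_trans with (z * z ^ (k - 1)).
            + apply Rmult_le_compat_l; [lra|]. apply pow_incr; lra.
            + replace k with (S (k - 1)) at 2 by lia. simpl; lra.
          - replace k with (S (k - 1)) at 1 by lia. simpl; ring. }
        assert (Hz0 : 0 <= z) by lra.
        pose proof (pow_incr z _ 2 (conj Hz0 Hr)) as H.
        rewrite Rpow_mult_distr in H. pose proof (pow2_ge_0 X). nra. }
    assert (Hz3 : (z ^ k) ^ 3 <= K ^ 3 * (X ^ k) ^ 3 * y ^ 3).
    { rewrite <- !Rpow_mult_distr. apply pow_incr; lra. }
    pose proof (pow_mul_exp_le 3 y ltac:(lia) Hy) as E3.
    pose proof (pow_mul_exp_le 5 y ltac:(lia) Hy) as E5.
    replace (INR 3 ^ 3) with 27 in E3 by (simpl; ring).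
    replace (INR 5 ^ 5) with 3125 in E5 by (simpl; ring).
    pose proof (exp_pos (- y)) as He.
    assert (Hsq : (X + z) ^ 2 <= X ^ 2 * (4 + 2 * (K * y) ^ 2)).
    { pose proof (pow2_ge_0 (X - z)). lra. }
    assert (HA : 0 <= K ^ 3 * (X ^ k) ^ 3).
    { apply Rmult_le_pos; repeat apply pow_le; lra. }
    apply Rle_trans with
      (K ^ 3 * (X ^ k) ^ 3 * y ^ 3 * exp (- y) * (X ^ 2 * (4 + 2 * (K * y) ^ 2))).
    - apply Rmult_le_compat; [|apply pow2_ge_0| |easy].
      + apply Rmult_le_pos; [apply pow_le; lra|lra].
      + apply Rmult_le_compat_r; lra.
    - replace (K ^ 3 * (X ^ k) ^ 3 * y ^ 3 * exp (- y) * (X ^ 2 * (4 + 2 * (K * y) ^ 2)))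
        with (K ^ 3 * (X ^ k) ^ 3 * X ^ 2
          * (4 * (y ^ 3 * exp (- y)) + 2 * K ^ 2 * (y ^ 5 * exp (- y)))) by ring.
      unfold C0.
      replace (K ^ 3 * (108 + 6250 * K ^ 2) * (X ^ k) ^ 3 * X ^ 2)
        with (K ^ 3 * (X ^ k) ^ 3 * X ^ 2 * (4 * 27 + 2 * K ^ 2 * 3125)) by ring.
      apply Rmult_le_compat_l.
      + apply Rmult_le_pos; [easy|apply pow2_ge_0].
      + apply Rplus_le_compat; apply Rmult_le_compat_l; try lra.
        pose proof (pow2_ge_0 K). lra. }
  assert (Hsum : psum (fun n => (INR n ^ k) ^ 3 * exp (- (s * INR n ^ k))) L
                 <= C0 * X ^ 2 * (/ X - / (X + INR L))).
  { induction L as [|L IH].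
    - simpl. rewrite Rplus_0_r. right; ring.
    - rewrite psum_S. specialize (Hterm (S L) ltac:(lia)).
      set (G := (INR (S L) ^ k) ^ 3 * _) in *.
      rewrite S_INR in Hterm |- *. set (l := INR L) in *.
      assert (Hl : 0 <= l) by apply pos_INR.
      enough (G <= C0 * X ^ 2 * (/ (X + l) - / (X + (l + 1)))) by lra.
      replace (/ (X + l) - / (X + (l + 1))) with (/ ((X + l) * (X + (l + 1)))) by (field; lra).
      apply Rmult_le_reg_r with ((X + l) * (X + (l + 1))); [nra|].
      rewrite (Rmult_assoc (C0 * X ^ 2)), Rinv_l, Rmult_1_r by nra.
      apply Rle_trans with (2 := Hterm). apply Rmult_le_compat_l; [|nra].
      apply Rmult_le_pos; [apply pow_le, pow_le, pos_INR|apply Rlt_le, exp_pos]. }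
  apply Rle_trans with (1 := Hsum). fold C0.
  assert (0 < / (X + INR L)) by (apply Rinv_0_lt_compat; pose proof (pos_INR L); lra).
  apply Rle_trans with (C0 * X ^ 2 * / X).
  - apply Rmult_le_compat_l; [|lra]. apply Rmult_le_pos; [easy|apply pow2_ge_0].
  - right. field. lra.
Qed.

(** * Bounds at a fixed scale *)

(** The constant of psum_cubic_exp_le. *)
Definition cubic_const (K : R) : R := K ^ 3 * (108 + 6250 * K ^ 2).

Lemma cubic_const_pos (K : R) : 0 < K -> 0 < cubic_const K.
Proof.
  intros HK. unfold cubic_const. pose proof (pow_lt K 3 HK). pose proof (pow2_ge_0 K). nra.
Qed.

Lemma pow_exp_opp (s : R) (k n : nat) : exp (- s) ^ (n ^ k) = exp (- (s * INR n ^ k)).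
Proof. rewrite <- exp_mul_INR, pow_INR. f_equal. ring. Qed.

Lemma bern_le_exp (k n : nat) (s : R) : bern k (exp (- s)) n <= exp (- (s * INR n ^ k)).
Proof.
  unfold bern. rewrite pow_exp_opp. pose proof (exp_pos (- (s * INR n ^ k))).
  apply Rle_div_l; nra.
Qed.

Lemma bern_var_bounds (k n : nat) (s : R) :
  0 <= bern k (exp (- s)) n * (1 - bern k (exp (- s)) n) <= exp (- (s * INR n ^ k)).
Proof.
  pose proof (bern_spec k n (exp (- s)) (Rlt_le _ _ (exp_pos _))) as [_ Hb].
  pose proof (bern_le_exp k n s). set (p := bern k (exp (- s)) n) in *. nra.
Qed.

Lemma bern_var_ge (k n N : nat) (s : R) :
  0 < s -> s * INR N ^ k <= 1 -> (n <= N)%nat ->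
  / 12 <= bern k (exp (- s)) n * (1 - bern k (exp (- s)) n).
Proof.
  intros Hs HN Hn. unfold bern. rewrite pow_exp_opp.
  assert (Hy : 0 <= s * INR n ^ k <= 1).
  { pose proof (pow_le (INR n) k (pos_INR n)).
    pose proof (pow_incr (INR n) (INR N) k (conj (pos_INR n) (le_INR _ _ Hn))). nra. }
  set (y := s * INR n ^ k) in *.
  assert (Hx : / 3 <= exp (- y) <= 1).
  { split.
    - apply Rle_trans with (exp (- (1))); [|apply exp_incr; lra].
      rewrite exp_Ropp. apply Rinv_le_contravar; [apply exp_pos|apply exp_le_3].
    - rewrite <- exp_0. apply exp_incr. lra. }
  set (x := exp (- y)) in *.
  replace (x / (1 + x) * (1 - x / (1 + x))) with (x / (1 + x) ^ 2) by (field; lra).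
  apply Rle_div_r; nra.
Qed.

(** s is comparable to N ^ (- k). *)
Definition matched (k N : nat) (s K : R) : Prop :=
  (1 <= k)%nat /\ (1 <= N)%nat /\ 0 < s /\ s * INR N ^ k <= 1 /\ 1 <= K * (s * INR N ^ k).

Definition cubic_bound (k N : nat) (K : R) : R :=
  cubic_const K * (INR N ^ k) ^ 3 * INR N.

Lemma exp_opp_in_unit (s : R) : 0 < s -> 0 < exp (- s) < 1.
Proof.
  intros Hs. split; [apply exp_pos|]. rewrite <- exp_0. apply exp_increasing. lra.
Qed.

Lemma ex_lim_mean_var (k N : nat) (s K : R) :
  matched k N s K ->
  let t := exp (- s) in
  exists mu V : R, is_lim_seq (mean_upto k t) mu /\ is_lim_seq (var_upto k t) V /\
    (INR N ^ k) ^ 2 / 12 <= V <= cubic_bound k N K.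
Proof.
  intros HK.
  pose proof HK as (Hk & HN & Hs & HsN & HKN).
  intros t. pose proof (exp_opp_in_unit s Hs) as Ht. fold t in Ht.
  pose proof (psum_cubic_exp_le k N s K Hk HN Hs HKN) as Hcub. fold (cubic_const K) in Hcub.
  fold (cubic_bound k N K) in Hcub. set (B := cubic_bound k N K) in *.
  assert (Hn1 : forall n, (1 <= n)%nat -> 1 <= INR n ^ k).
  { intros n Hn. apply pow_R1_Rle. now apply (le_INR 1). }
  destruct (ex_finite_lim_seq_incr (mean_upto k t) B) as [mu Hmu].
  - intros n. unfold mean_upto. rewrite psum_S.
    pose proof (bern_spec k (S n) t ltac:(lra)) as [_ Hb].
    pose proof (Hn1 (S n) ltac:(lia)). nra.
  - intros n. apply Rle_trans with (2 := Hcub n). apply psum_le. intros i Hi.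
    pose proof (bern_spec k i t ltac:(lra)) as [_ Hb].
    apply Rmult_le_compat; [apply pow_le, pos_INR|lra| |apply bern_le_exp].
    pose proof (Hn1 i ltac:(lia)) as H. pose proof (pow_R1_Rle _ 2 H). simpl in *. nra.
  - assert (Hinc : forall n, var_upto k t n <= var_upto k t (S n)).
    { intros n. unfold var_upto. rewrite psum_S.
      pose proof (bern_var_bounds k (S n) s) as Hb. fold t in Hb.
      pose proof (pow2_ge_0 (INR (S n) ^ k)).
      set (a := bern _ _ _ * _) in *. nra. }
    assert (HB : forall n, var_upto k t n <= B).
    { intros n. apply Rle_trans with (2 := Hcub n). apply psum_le. intros i Hi.
      apply Rmult_le_compat; [apply pow2_ge_0|apply bern_var_bounds| |apply bern_var_bounds].
      pose proof (Hn1 i ltac:(lia)) as H. apply Rle_pow; [easy|lia]. }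
    destruct (ex_finite_lim_seq_incr (var_upto k t) B Hinc HB) as [V HV].
    exists mu, V. repeat split; try easy.
    + apply Rle_trans with (var_upto k t N).
      * apply Rle_trans with
          ((INR N ^ k) ^ 2 * (bern k t N * (1 - bern k t N))).
        { apply Rmult_le_compat_l; [apply pow2_ge_0|].
          exact (bern_var_ge k N N s Hs HsN (le_n _)). }
        apply (term_le_psum (fun n => (INR n ^ k) ^ 2 * (bern k t n * (1 - bern k t n))));
          [|lia].
        intros n. apply Rmult_le_pos; [apply pow2_ge_0|apply bern_var_bounds].
      * now apply is_lim_seq_incr_compare.
    + apply (is_lim_seq_le (var_upto k t) (fun _ => B) V B); [easy|easy|apply is_lim_seq_const].
Qed.

Lemma sigma_bounds (k N : nat) (s K : R) :
  matched k N s K ->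
  let t := exp (- s) in
  (INR N ^ k) ^ 2 / 12 <= khinchin_sigma (Q_series k) t ^ 2 <= cubic_bound k N K /\
  0 < khinchin_sigma (Q_series k) t /\
  is_lim_seq (var_upto k t) (khinchin_sigma (Q_series k) t ^ 2).
Proof.
  intros HK.
  pose proof HK as (Hk & HN & Hs & HsN & HKN).
  intros t. pose proof (exp_opp_in_unit s Hs) as Ht. fold t in Ht.
  destruct (ex_lim_mean_var k N s K HK) as (mu & V & Hmu & HV & HVb).
  assert (H0 : 0 < (INR N ^ k) ^ 2 / 12).
  { apply Rdiv_lt_0_compat; [|lra]. apply pow_lt, pow_lt, lt_0_INR. lia. }
  unfold khinchin_sigma. rewrite (khinchin_var_Q k t mu V) by (assumption || lra).
  rewrite pow2_sqrt by lra. repeat split; try easy; try lra.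
  apply sqrt_lt_R0. lra.
Qed.

(** Since |u| <= s, the products v ^ 2 p (1 - p) and |v| p (1 - p), with
    v = u n ^ k, are bounded: p (1 - p) decays like exp (- s n ^ k). *)
Lemma charfun_major_arc (k N : nat) (s K theta : R) :
  matched k N s K ->
  let t := exp (- s) in
  let sigma := khinchin_sigma (Q_series k) t in
  let u := theta / sigma in
  Rabs u <= s ->
  Cmod (khinchin_charfun (Q_series k) t theta * RtoC (exp (theta ^ 2 / 2)) - RtoC 1)%C
  <= exp (12 * (Rabs u ^ 3 * cubic_bound k N K)) - 1.
Proof.
  intros HK.
  pose proof HK as (Hk & HN & Hs & HsN & HKN).
  intros t sigma u Hu. pose proof (exp_opp_in_unit s Hs) as Ht. fold t in Ht.
  destruct (sigma_bounds k N s K HK) as (_ & Hsig & HV). fold t sigma in Hsig, HV.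
  destruct (ex_lim_mean_var k N s K HK) as (mu & _ & Hmu & _).
  pose proof (khinchin_charfun_Q k t mu theta Hk ltac:(lra) Hmu) as HC.
  fold sigma in HC. fold u in HC.
  set (g := fun n => (u * INR n ^ k) ^ 2 * (bern k t n * (1 - bern k t n)) / 2).
  assert (Hg : forall L, psum g L = u ^ 2 / 2 * var_upto k t L).
  { intros L. unfold var_upto. rewrite <- psum_scal. apply psum_ext. intros n _.
    unfold g. field. }
  assert (Hexp : is_lim_seq (fun L => exp (psum g L)) (exp (theta ^ 2 / 2))).
  { apply is_lim_seq_continuous; [apply derivable_continuous, derivable_exp|].
    eapply is_lim_seq_ext; [intros n; symmetry; apply Hg|].
    assert (Hth : theta ^ 2 / 2 = u ^ 2 / 2 * sigma ^ 2).
    { unfold u. field. lra. }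
    rewrite Hth.
    now apply (is_lim_seq_scal_l (var_upto k t) (u ^ 2 / 2) (sigma ^ 2)). }
  eapply Cmod_Clim_le.
  - apply Clim_minus.
    + apply Clim_mult; [exact HC|apply Clim_RtoC, Hexp].
    + apply Clim_RtoC, is_lim_seq_const.
  - exists 0%nat. intros L _. rewrite cprod_mult_exp.
    set (e := fun n => 12 * (Rabs u ^ 3 * ((INR n ^ k) ^ 3 * exp (- (s * INR n ^ k))))).
    apply Rle_trans with (exp (psum e L) - 1).
    + apply Cmod_cprod_minus_1. intros n. unfold Q_factor, g.
      pose proof (bern_spec k n t ltac:(lra)) as [_ Hb].
      pose proof (bern_var_bounds k n s) as Ha. fold t in Ha.
      assert (Hnk : 0 <= INR n ^ k) by apply pow_le, pos_INR.
      assert (Hv : Rabs (u * INR n ^ k) <= s * INR n ^ k).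
      { rewrite Rabs_mult, (Rabs_pos_eq (INR n ^ k)) by easy. nra. }
      set (y := s * INR n ^ k) in *. assert (Hy : 0 <= y) by (unfold y; nra).
      pose proof (pow_mul_exp_le 1 y ltac:(lia) Hy) as E1.
      pose proof (pow_mul_exp_le 2 y ltac:(lia) Hy) as E2.
      simpl INR in E1, E2.
      eapply Rle_trans; [apply bern_charfun_gaussian|].
      * lra.
      * rewrite <- pow2_abs. apply Rle_trans with (y ^ 2 * exp (- y)); [|simpl in *; lra].
        apply Rmult_le_compat; [apply pow2_ge_0|easy| |easy].
        apply pow_incr. split; [apply Rabs_pos|easy].
      * apply Rle_trans with (y * exp (- y)); [|simpl in *; lra].
        apply Rmult_le_compat; [apply Rabs_pos|easy|easy|easy].
      * unfold e. apply Rmult_le_compat_l; [lra|]. fold y.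
        rewrite Rabs_mult, (Rabs_pos_eq (INR n ^ k)), Rpow_mult_distr, Rmult_assoc by easy.
        apply Rmult_le_compat_l; [apply pow_le, Rabs_pos|].
        apply Rmult_le_compat_l; [now apply pow_le|easy].
    + apply Rplus_le_compat_r, exp_incr. unfold e. rewrite !psum_scal.
      apply Rmult_le_compat_l; [lra|].
      apply Rmult_le_compat_l; [apply pow_le, Rabs_pos|].
      now apply psum_cubic_exp_le.
Qed.

(** Only the first N factors are used, where the Bernoulli variances are
    bounded below. *)
Lemma charfun_energy (k N : nat) (s K theta : R) :
  matched k N s K ->
  let t := exp (- s) in
  let u := theta / khinchin_sigma (Q_series k) t in
  Cmod (khinchin_charfun (Q_series k) t theta)
  <= exp (- (sin_energy k (u / 2) N / 6)).
Proof.
  intros HK.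
  pose proof HK as (Hk & HN & Hs & HsN & HKN).
  intros t u. pose proof (exp_opp_in_unit s Hs) as Ht. fold t in Ht.
  destruct (ex_lim_mean_var k N s K HK) as (mu & _ & Hmu & _).
  pose proof (khinchin_charfun_Q k t mu theta Hk ltac:(lra) Hmu) as HC. fold u in HC.
  apply (Cmod_Clim_le _ _ _ HC).
  exists N. intros L HL.
  set (g := fun n => 2 * (bern k t n * (1 - bern k t n)) * sin (u * INR n ^ k / 2) ^ 2).
  assert (Hg : forall n, 0 <= g n).
  { intros n. apply Rmult_le_pos; [|apply pow2_ge_0].
    pose proof (bern_var_bounds k n s) as H. fold t in H. lra. }
  apply Rle_trans with (exp (- psum g L)).
  - apply Cmod_cprod_le. intros n. apply Cmod_bern_charfun_le.
    pose proof (bern_spec k n t ltac:(lra)) as [_ Hb]. lra.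
  - apply exp_incr, Ropp_le_contravar.
    apply Rle_trans with (psum g N); [|now apply psum_mono].
    unfold sin_energy, Rdiv. rewrite Rmult_comm, <- psum_scal.
    apply psum_le. intros n Hn. unfold g.
    pose proof (bern_var_ge k n N s Hs HsN ltac:(lia)) as H. fold t in H.
    replace (u * / 2 * INR n ^ k) with (u * INR n ^ k / 2) by field.
    apply Rmult_le_compat_r; [apply pow2_ge_0|lra].
Qed.

(** * Limits as t tends to 1 *)

Lemma sup_nonneg_bounds (P : R -> Prop) (g : R -> R) (b : R) :
  0 <= b -> (forall x, P x -> g x <= b) -> 0 <= sup_nonneg P g <= b.
Proof.
  intros Hb H. unfold sup_nonneg.
  destruct (Lub_Rbar_correct (fun y => y = 0 \/ exists x, P x /\ y = g x)) as [H1 H2].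
  assert (H3 : Rbar_le (Lub_Rbar (fun y => y = 0 \/ exists x, P x /\ y = g x)) b).
  { apply H2. intros y [-> | (x & Hx & ->)]; simpl; [easy|now apply H]. }
  specialize (H1 0 (or_introl eq_refl)).
  destruct (Lub_Rbar _) as [l| |]; simpl in *; [lra|easy|easy].
Qed.

(** The integer part M of s ^ (- 1 / (5 k)), where t = exp (- s). The number of
    terms in the sine sums is N = M ^ 5, so that s is comparable to N ^ (- k) and
    the factor N ^ (- 2/5) of the cut is the integral power M ^ (- 2). *)
Definition scale (k : nat) (t : R) : nat :=
  Z.to_nat (Int_part (Rpower (/ - ln t) (/ INR (5 * k)))).

Lemma scale_spec (k : nat) (t : R) :
  (1 <= k)%nat -> 0 < t < 1 ->
  - ln t * INR (scale k t) ^ (5 * k) <= 1 <= - ln t * INR (S (scale k t)) ^ (5 * k).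
Proof.
  intros Hk Ht.
  assert (Hs : 0 < - ln t).
  { pose proof (ln_increasing t 1 ltac:(lra) ltac:(lra)) as H. rewrite ln_1 in H. lra. }
  set (s := - ln t) in *. unfold scale. fold s.
  set (x := Rpower (/ s) (/ INR (5 * k))).
  assert (Hx : 0 < x) by apply exp_pos.
  assert (Hn : 0 < INR (5 * k)) by (apply lt_0_INR; lia).
  assert (Hxn : s * x ^ (5 * k) = 1).
  { rewrite <- Rpower_pow by easy. unfold x. rewrite Rpower_mult, Rinv_l by lra.
    rewrite Rpower_1 by (now apply Rinv_0_lt_compat). field. lra. }
  destruct (base_Int_part x) as [H1 H2].
  assert (Hz : (0 <= Int_part x)%Z).
  { assert (-1 < Int_part x)%Z by (apply lt_IZR; lra). lia. }
  assert (HM : INR (Z.to_nat (Int_part x)) = IZR (Int_part x)).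
  { now rewrite INR_IZR_INZ, Z2Nat.id. }
  set (M := Z.to_nat (Int_part x)) in *.
  rewrite S_INR, HM, <- Hxn. rewrite <- HM in *. pose proof (pos_INR M).
  split; apply Rmult_le_compat_l; try lra; apply pow_incr; lra.
Qed.

Lemma at_left_1_scale (k M : nat) (Q : R -> Prop) :
  (1 <= k)%nat ->
  (forall t, 0 < t < 1 -> (M <= scale k t)%nat -> Q t) -> Rbar_at_left 1 Q.
Proof.
  intros Hk H.
  set (X := INR (S M) ^ (5 * k)).
  assert (HX : 0 < X) by (apply pow_lt, lt_0_INR; lia).
  assert (He : 0 < 1 - exp (- / X)).
  { pose proof (Rinv_0_lt_compat X HX).
    pose proof (exp_increasing (- / X) 0 ltac:(lra)) as H1. rewrite exp_0 in H1. lra. }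
  exists (mkposreal _ He). intros t Hb Ht1. simpl in Ht1.
  apply Rabs_def2 in Hb. unfold minus, plus, opp in Hb; simpl in Hb.
  pose proof (exp_pos (- / X)).
  assert (Ht : 0 < t < 1) by lra.
  apply H; [easy|].
  destruct (Nat.le_gt_cases M (scale k t)) as [h|h]; [easy|exfalso].
  pose proof (scale_spec k t Hk Ht) as [_ H2].
  pose proof (ln_increasing (exp (- / X)) t ltac:(lra) ltac:(lra)) as H3.
  rewrite ln_exp in H3.
  assert (H4 : INR (S (scale k t)) ^ (5 * k) <= X).
  { apply pow_incr. split; [apply pos_INR|]. apply le_INR. lia. }
  assert (H5 : - ln t * X < 1).
  { apply Rmult_lt_reg_r with (/ X); [now apply Rinv_0_lt_compat|].
    rewrite Rmult_assoc, Rinv_r by lra. lra. }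
  assert (0 < - ln t).
  { pose proof (ln_increasing t 1 ltac:(lra) ltac:(lra)) as H6. rewrite ln_1 in H6. lra. }
  nra.
Qed.

Lemma filterlim_at_left_1_0 (k M : nat) (f : R -> R) (g : nat -> R) :
  (1 <= k)%nat -> is_lim_seq g 0 ->
  (forall t, 0 < t < 1 -> (M <= scale k t)%nat -> 0 <= f t <= g (scale k t)) ->
  filterlim f (Rbar_at_left 1) (locally 0).
Proof.
  intros Hk Hg Hf P [eps HP]. unfold filtermap.
  apply is_lim_seq_spec in Hg. destruct (Hg eps) as [N HN].
  apply (at_left_1_scale k (M + N)); [easy|]. intros t Ht HM.
  specialize (Hf t Ht ltac:(lia)). specialize (HN (scale k t) ltac:(lia)).
  apply Rabs_def2 in HN. apply HP.
  change (Rabs (f t - 0) < eps). apply Rabs_def1; lra.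
Qed.

Lemma is_lim_seq_div_INR (a : R) : is_lim_seq (fun n => a / INR n) 0.
Proof.
  replace (Finite 0) with (Rbar_mult a (Rbar_inv p_infty)) by (simpl; now rewrite Rmult_0_r).
  apply is_lim_seq_scal_l. apply is_lim_seq_inv; [apply is_lim_seq_INR|easy].
Qed.

Lemma pow_exp_opp_le (n M : nat) (c : R) :
  0 < c -> (1 <= M)%nat ->
  INR M ^ n * exp (- (c * INR M)) <= (INR (S n) / c) ^ S n / INR M.
Proof.
  intros Hc HM. assert (HM' : 1 <= INR M) by now apply (le_INR 1).
  pose proof (pow_mul_exp_le (S n) (c * INR M) ltac:(lia) ltac:(nra)) as H.
  apply (Rle_div_r _ _ (INR M)); [lra|]. unfold Rdiv. rewrite (Rpow_mult_distr (INR (S n))), pow_inv.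
  assert (Hcn : 0 < c ^ S n) by now apply pow_lt.
  apply Rmult_le_reg_r with (c ^ S n); [easy|].
  rewrite (Rmult_assoc (INR (S n) ^ S n)), Rinv_l, Rmult_1_r by lra.
  rewrite Rpow_mult_distr in H. eapply Rle_trans; [|exact H]. right. simpl. ring.
Qed.

(** N ^ (- k - 2/5) for N = M ^ 5. The exponent - 2/5 lies between - 1/2, below
    which the Gaussian is not yet small at the cut, and - 1/3, above which the
    cubic errors on the major arc do not tend to 0. The maximum with 1 gives a
    positive value when M = 0. *)
Definition cut (k : nat) (t : R) : R := / INR (Nat.max 1 (scale k t)) ^ (5 * k + 2).

Lemma cut_bounds (k : nat) (t : R) : 0 < cut k t <= PI.
Proof.
  unfold cut. set (m := INR (Nat.max 1 (scale k t))).
  assert (Hm : 1 <= m) by (apply (le_INR 1); lia).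
  pose proof (pow_R1_Rle m (5 * k + 2) Hm) as H.
  split; [apply Rinv_0_lt_compat; lra|].
  pose proof PI2_1. pose proof (Rinv_le_contravar 1 _ Rlt_0_1 H) as H1.
  rewrite Rinv_1 in H1. lra.
Qed.

Lemma scale_params (k : nat) (t : R) :
  (1 <= k)%nat -> 0 < t < 1 -> (1 <= scale k t)%nat ->
  let s := - ln t in let N := (scale k t ^ 5)%nat in
  exp (- s) = t /\ 0 < s /\ (1 <= N)%nat /\ (scale k t <= N)%nat /\
  s * INR N ^ k <= 1 /\ 1 <= 32 ^ k * (s * INR N ^ k) /\
  INR N ^ k = INR (scale k t) ^ (5 * k).
Proof.
  intros Hk Ht HM s N.
  pose proof (scale_spec k t Hk Ht) as [H1 H2]. fold s in H1, H2.
  assert (HX : INR N ^ k = INR (scale k t) ^ (5 * k)).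
  { unfold N. now rewrite pow_INR, <- pow_mult. }
  assert (Hs : 0 < s).
  { unfold s. pose proof (ln_increasing t 1 ltac:(lra) ltac:(lra)) as H. rewrite ln_1 in H. lra. }
  set (M := scale k t) in *.
  assert (HMN : (M <= N)%nat) by (apply le_pow_k; lia).
  repeat split; try easy; try lia.
  - unfold s. rewrite Ropp_involutive. now apply exp_ln.
  - now rewrite HX.
  - rewrite HX. apply Rle_trans with (1 := H2).
    replace (32 ^ k * (s * INR M ^ (5 * k))) with (s * (2 * INR M) ^ (5 * k)).
    + apply Rmult_le_compat_l; [lra|]. apply pow_incr. rewrite S_INR.
      assert (1 <= INR M) by now apply (le_INR 1). lra.
    + rewrite Rpow_mult_distr, (pow_mult 2). replace (2 ^ 5) with 32 by ring. ring.
Qed.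

Lemma cut_eq (k : nat) (t : R) :
  (1 <= scale k t)%nat ->
  cut k t * INR (scale k t) ^ (5 * k) = / INR (scale k t) ^ 2.
Proof.
  intros HM. unfold cut. rewrite (Nat.max_r 1) by easy.
  assert (0 < INR (scale k t)) by (apply lt_0_INR; lia).
  rewrite pow_add. field. split; try apply pow_nonzero; lra.
Qed.

Lemma sigma_at_left_1 (k : nat) :
  (1 <= k)%nat ->
  filterlim (khinchin_sigma (Q_series k)) (Rbar_at_left 1) (Rbar_locally p_infty).
Proof.
  intros Hk P [b HP]. unfold filtermap.
  destruct (INR_unbounded (4 * b)) as [m Hm].
  apply (at_left_1_scale k (S m)); [easy|]. intros t Ht HM.
  destruct (scale_params k t Hk Ht ltac:(lia)) as (Et & Hs & HN & HMN & HsN & HKN & HX).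
  destruct (sigma_bounds k _ _ _ (conj Hk (conj HN (conj Hs (conj HsN HKN)))))
    as ([H1 _] & H2 & _).
  rewrite Et in H1, H2. apply HP. set (sigma := khinchin_sigma _ _) in *.
  set (M := scale k t) in *.
  assert (HM1 : INR m <= INR M) by (apply le_INR; lia).
  assert (HMX : INR M <= INR (M ^ 5) ^ k).
  { rewrite <- pow_INR. apply le_INR. apply Nat.le_trans with (1 := HMN). now apply le_pow_k. }
  pose proof (pos_INR M) as HM0.
  pose proof (pow_incr (INR M) _ 2 (conj HM0 HMX)) as Hsq.
  destruct (Rle_lt_dec (INR M / 4) sigma) as [h|h]; [lra|]. nra.
Qed.

Lemma major_arc_limit (k : nat) :
  (1 <= k)%nat ->
  filterlim
    (fun t =>
       sup_nonneg
         (fun theta => Rabs theta <= cut k t * khinchin_sigma (Q_series k) t)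
         (fun theta =>
            Cmod (khinchin_charfun (Q_series k) t theta * RtoC (exp (theta ^ 2 / 2))
                  - RtoC 1)%C))
    (Rbar_at_left 1) (locally 0).
Proof.
  intros Hk. set (C0 := cubic_const (32 ^ k)).
  assert (HC0 : 0 < C0) by (apply cubic_const_pos, pow_lt; lra).
  apply (filterlim_at_left_1_0 k (32 ^ k) _ (fun M => exp (12 * C0 / INR M) - 1)); [easy| |].
  - replace (Finite 0) with (Finite (exp 0 - 1)) by (rewrite exp_0; f_equal; ring).
    apply is_lim_seq_minus'; [|apply is_lim_seq_const].
    apply is_lim_seq_continuous; [apply derivable_continuous, derivable_exp|].
    apply is_lim_seq_div_INR.
  - intros t Ht HM.
    assert (H32 : (1 <= 32 ^ k)%nat) by (pose proof (Nat.pow_nonzero 32 k); lia).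
    assert (HM1 : (1 <= scale k t)%nat) by lia.
    destruct (scale_params k t Hk Ht HM1) as (Et & Hs & HN & HMN & HsN & HKN & HX).
    pose proof (conj Hk (conj HN (conj Hs (conj HsN HKN)))) as HK.
    pose proof (sigma_bounds k _ _ _ HK) as (_ & Hsig & _).
    pose proof (cut_eq k t HM1) as Hcut. rewrite <- HX in Hcut.
    rewrite Et in Hsig. set (sigma := khinchin_sigma _ _) in *.
    set (M := scale k t) in *. set (X := INR (M ^ 5) ^ k) in *. set (s := - ln t) in *.
    assert (HM' : 1 <= INR M) by now apply (le_INR 1).
    assert (HX0 : 0 < X) by (apply pow_lt, lt_0_INR; lia).
    assert (HM32 : 32 ^ k <= INR M).
    { replace 32 with (INR 32) by (simpl; ring). rewrite <- pow_INR. now apply le_INR. }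
    assert (H32' : 0 < 32 ^ k) by (apply pow_lt; lra).
    assert (HiM : 0 < / INR M ^ 2) by (apply Rinv_0_lt_compat, pow_lt; lra).
    assert (HiM2 : INR M ^ 2 * / INR M ^ 2 = 1) by (apply Rinv_r, pow_nonzero; lra).
    assert (Hexp0 : 0 <= exp (12 * C0 / INR M) - 1).
    { assert (H : 0 <= 12 * C0 / INR M) by (apply Rdiv_le_0_compat; lra).
      apply exp_incr in H. rewrite exp_0 in H. lra. }
    apply sup_nonneg_bounds; [easy|]. intros theta Htheta.
    set (u := theta / sigma).
    assert (Hu : Rabs u <= cut k t).
    { unfold u, Rdiv. rewrite Rabs_mult, Rabs_inv, (Rabs_pos_eq sigma) by lra.
      apply Rle_div_l; lra. }
    assert (HuX : Rabs u * X <= / INR M ^ 2) by (rewrite <- Hcut; nra).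
    assert (Hus : Rabs u <= s).
    { apply Rmult_le_reg_r with X; [easy|]. apply Rle_trans with (1 := HuX).
      apply Rmult_le_reg_l with (32 ^ k); [easy|]. apply Rle_trans with (2 := HKN).
      rewrite <- HiM2. apply Rmult_le_compat_r; [lra|]. nra. }
    pose proof (charfun_major_arc k _ s _ theta HK) as H. cbv zeta in H. rewrite Et in H.
    fold sigma in H. fold u in H. specialize (H Hus).
    apply Rle_trans with (1 := H). apply Rplus_le_compat_r, exp_incr.
    unfold Rdiv. rewrite Rmult_assoc. apply Rmult_le_compat_l; [lra|].
    unfold cubic_bound. fold C0 X.
    replace (Rabs u ^ 3 * (C0 * X ^ 3 * INR (M ^ 5)))
      with (C0 * ((Rabs u * X) ^ 3 * INR M ^ 5)) by (rewrite pow_INR; ring).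
    apply Rmult_le_compat_l; [lra|].
    apply Rle_trans with ((/ INR M ^ 2) ^ 3 * INR M ^ 5).
    + apply Rmult_le_compat_r; [apply pow_le; lra|]. apply pow_incr. split; [|easy].
      apply Rmult_le_pos; [apply Rabs_pos|lra].
    + right. field. lra.
Qed.

Lemma minor_arc_limit (k : nat) :
  (1 <= k)%nat ->
  filterlim
    (fun t =>
       khinchin_sigma (Q_series k) t *
       sup_nonneg
         (fun theta => cut k t * khinchin_sigma (Q_series k) t < Rabs theta
                       <= PI * khinchin_sigma (Q_series k) t)
         (fun theta => Cmod (khinchin_charfun (Q_series k) t theta)))
    (Rbar_at_left 1) (locally 0).
Proof.
  intros Hk. set (C0 := cubic_const (32 ^ k)).
  assert (HC0 : 0 < C0) by (apply cubic_const_pos, pow_lt; lra).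
  destruct (sin_energy_lower_bound k Hk) as (c & Hc & Henergy).
  set (n := (15 * k + 5)%nat).
  apply (filterlim_at_left_1_0 k (2 * k + fact k) _
    (fun M => (1 + C0) * (INR (S n) / (c / 24)) ^ S n / INR M)); [easy| |].
  - apply is_lim_seq_div_INR.
  - intros t Ht HM.
    assert (HM1 : (1 <= scale k t)%nat) by lia.
    destruct (scale_params k t Hk Ht HM1) as (Et & Hs & HN & HMN & HsN & HKN & HX).
    pose proof (conj Hk (conj HN (conj Hs (conj HsN HKN)))) as HK.
    pose proof (sigma_bounds k _ _ _ HK) as ([_ HsigB] & Hsig & _).
    pose proof (cut_eq k t HM1) as Hcut. rewrite <- HX in Hcut.
    rewrite Et in Hsig, HsigB. set (sigma := khinchin_sigma _ _) in *.
    set (M := scale k t) in *. set (X := INR (M ^ 5) ^ k) in *. set (s := - ln t) in *.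
    assert (HM' : 1 <= INR M) by now apply (le_INR 1).
    assert (HX0 : 0 < X) by (apply pow_lt, lt_0_INR; lia).
    assert (HiM : 0 < / INR M ^ 2) by (apply Rinv_0_lt_compat, pow_lt; lra).
    assert (HiM2 : INR M ^ 2 * / INR M ^ 2 = 1) by (apply Rinv_r, pow_nonzero; lra).
    assert (Hsup : 0 <= sup_nonneg
        (fun theta => cut k t * sigma < Rabs theta <= PI * sigma)
        (fun theta => Cmod (khinchin_charfun (Q_series k) t theta))
        <= exp (- (c / 24 * INR M))).
    { apply sup_nonneg_bounds; [apply Rlt_le, exp_pos|]. intros theta [Hth1 Hth2].
      pose proof (charfun_energy k _ s _ theta HK) as H. cbv zeta in H. rewrite Et in H.
      fold sigma in H. apply Rle_trans with (1 := H). apply exp_incr, Ropp_le_contravar.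
      set (u := theta / sigma).
      assert (Hu : Rabs theta = Rabs u * sigma).
      { rewrite <- (Rabs_pos_eq sigma) by lra. rewrite <- Rabs_mult.
        f_equal. unfold u. field. lra. }
      assert (Hu1 : cut k t <= Rabs u) by nra.
      assert (Hu2 : Rabs u <= PI) by nra.
      assert (Hu3 : Rabs (u / 2) = Rabs u / 2).
      { unfold Rdiv. rewrite Rabs_mult, (Rabs_pos_eq (/ 2)); lra. }
      assert (HuX : / INR M ^ 2 <= Rabs u * X) by (rewrite <- Hcut; nra).
      pose proof (pow_R1_Rle (INR M) 2 HM') as HM2.
      assert (Hi1 : / INR M ^ 2 <= 1).
      { rewrite <- Rinv_1. apply Rinv_le_contravar; lra. }
      pose proof (Henergy (M ^ 5)%nat (u / 2) (/ INR M ^ 2 / 2)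
        ltac:(lia) ltac:(lia) ltac:(lra) ltac:(lra)) as HE.
      fold X in HE. rewrite Hu3 in HE. specialize (HE ltac:(lra)).
      rewrite pow_INR in HE.
      replace (c * (/ INR M ^ 2 / 2) ^ 2 * INR M ^ 5) with (c * INR M / 4) in HE
        by (field; lra).
      lra. }
    set (sup := sup_nonneg _ _) in *. split; [apply Rmult_le_pos; lra|].
    assert (HMn : 1 <= INR M ^ n) by now apply pow_R1_Rle.
    assert (HB : cubic_bound k (M ^ 5) (32 ^ k) = C0 * INR M ^ n).
    { unfold cubic_bound. fold C0 X. rewrite HX, pow_INR, <- pow_mult, Rmult_assoc, <- pow_add.
      f_equal; f_equal. unfold n; lia. }
    rewrite HB in HsigB.
    assert (Hsig1 : sigma <= (1 + C0) * INR M ^ n).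
    { apply Rle_trans with (1 + sigma ^ 2); [pose proof (pow2_ge_0 (sigma - 1)); nra|]. nra. }
    apply Rle_trans with ((1 + C0) * INR M ^ n * exp (- (c / 24 * INR M))).
    + apply Rmult_le_compat; lra.
    + set (A := (INR (S n) / (c / 24)) ^ S n).
      replace ((1 + C0) * A / INR M) with ((1 + C0) * (A / INR M)) by (unfold Rdiv; ring).
      rewrite Rmult_assoc. apply Rmult_le_compat_l; [lra|].
      apply (pow_exp_opp_le n M (c / 24)); [lra|easy].
Qed.

Theorem mainTheorem3 : forall k : nat, (1 <= k)%nat -> in_Hayman (Q_series k).
Proof.
  intros k Hk. split; [now apply in_K_Q|].
  rewrite CV_radius_Q by easy. split; [now apply sigma_at_left_1|].
  exists (cut k). split; [intros; apply cut_bounds|].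
  split; [now apply major_arc_limit|now apply minor_arc_limit].
Qed.
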